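(* There exist finite simplicial graphs $\Gamma_1,\Gamma_2$ such that the Bestvina-Brady groups $B(\Gamma_1)$ and $B(\Gamma_2)$ have the same finiteness properties (for each $j$, one is of type $F_j$, respectively $FP_j$, if and only if the other is), are finitely presented with equivalent Dehn functions, and have the same asymptotic dimension, but the set of integers $n$ such that $F_2^n$ coarsely embeds in $B(\Gamma_1)$ is different from the set of integers $n$ such that $F_2^n$ coarsely embeds in $B(\Gamma_2)$.
   Context: For a finite simplicial graph $\Gamma$, $A(\Gamma)$ is the right-angled Artin group with one generator per vertex and commutation relations between adjacent vertices; the Bestvina-Brady group $B(\Gamma)$ is the kernel of the homomorphism $A(\Gamma)\to\mathbb Z$ sending every standard generator to $1$. Dehn functions are considered up to the usual equivalence $\asymp$. $F_2^n$ is the direct product of $n$ copies of the free group of rank 2. Finitely generated groups are given word metrics. A map $f:(A,d_A)\to(B,d_B)$ of metric spaces is a coarse embedding if there are functions $\rho_-,\rho_+:[0,\infty)\to[0,\infty)$ with $\rho_-(t)\to\infty$ as $t\to\infty$ and $\rho_-(d_A(x,y))\le d_B(f(x),f(y))\le\rho_+(d_A(x,y))$ for all $x,y$. *)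

(* Defs.v *)
From HB Require Import structures.
From mathcomp Require Import all_boot all_order all_algebra.
From mathcomp Require Import all_classical all_reals all_analysis.

Set Implicit Arguments.
Unset Strict Implicit.
Unset Printing Implicit Defensive.

Import Order.TTheory GRing.Theory Num.Theory.
Import numFieldNormedType.Exports.

Local Open Scope classical_set_scope.
Local Open Scope ring_scope.

Definition least (P : nat -> Prop) : option nat :=
  if pselect (exists n, `[< P n >]) is left exP then Some (ex_minn exP) else None.

(** The letter [(s, true)] is the generator [s], [(s, false)] its inverse. *)
Notation word S := (seq (S * bool)).

Definition wordV (S : Type) (w : word S) : word S :=
  rev [seq (l.1, ~~ l.2) | l <- w].

Inductive word_eqv (S : Type) (rels : word S -> Prop) : word S -> word S -> Prop :=
| WordRefl w : word_eqv rels w w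
| WordSym u w : word_eqv rels u w -> word_eqv rels w u
| WordTrans v u w : word_eqv rels u v -> word_eqv rels v w -> word_eqv rels u w
| WordCancel u w x b : word_eqv rels (u ++ (x, b) :: (x, ~~ b) :: w) (u ++ w)
| WordRel u w r : rels r -> word_eqv rels (u ++ r ++ w) (u ++ w).

Section PresentedGroup.
Variables (S : choiceType) (rels : word S -> Prop).
Local Notation eqv := (word_eqv rels).

Lemma word_eqv_cat2l v u w : eqv u w -> eqv (v ++ u) (v ++ w).
Proof.
elim=> {u w} [w|u w _|x u w _ ux _ xw|u w x b|u w r Rr].
- exact: WordRefl.
- exact: WordSym.
- exact: WordTrans ux xw.
- by rewrite !catA; exact: WordCancel.
- by rewrite (catA v u (r ++ w)) (catA v u w); exact: WordRel.
Qed.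

Lemma word_eqv_cat2r v u w : eqv u w -> eqv (u ++ v) (w ++ v).
Proof.
elim=> {u w} [w|u w _|x u w _ ux _ xw|u w x b|u w r Rr].
- exact: WordRefl.
- exact: WordSym.
- exact: WordTrans ux xw.
- by rewrite -!catA; exact: WordCancel.
- by rewrite -!catA; exact: WordRel.
Qed.

Lemma word_eqv_cat u u' w w' : eqv u u' -> eqv w w' -> eqv (u ++ w) (u' ++ w').
Proof.
move=> uu' ww'; apply: (@WordTrans _ _ (u' ++ w)); first exact: word_eqv_cat2r.
exact: word_eqv_cat2l.
Qed.

Lemma wordV_cons (l : S * bool) w : wordV (l :: w) = wordV w ++ [:: (l.1, ~~ l.2)].
Proof. by rewrite /wordV /= rev_cons cats1. Qed.

Lemma wordV_cat (u w : word S) : wordV (u ++ w) = wordV w ++ wordV u.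
Proof. by rewrite /wordV map_cat rev_cat. Qed.

Lemma wordVK : involutive (@wordV S).
Proof.
move=> w; rewrite /wordV map_rev revK -map_comp -[RHS]map_id.
by apply: eq_map => -[x b] /=; rewrite negbK.
Qed.

Lemma word_eqv_mulwV w : eqv (w ++ wordV w) [::].
Proof.
elim: w => [|[x b] w IHw] /=; first exact: WordRefl.
rewrite wordV_cons /= catA -cat1s -[X in eqv _ X]/([::] ++ [::]).
apply: (@WordTrans _ _ ([:: (x, b)] ++ [::] ++ [:: (x, ~~ b)])).
  by apply: word_eqv_cat2l; exact: word_eqv_cat2r.
exact: (@WordCancel _ _ [::] [::]).
Qed.

Lemma word_eqv_mulVw w : eqv (wordV w ++ w) [::].
Proof. by rewrite -{2}[w]wordVK; exact: word_eqv_mulwV. Qed.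

Lemma word_eqvV u w : eqv u w -> eqv (wordV u) (wordV w).
Proof.
move=> uw; apply: (@WordTrans _ _ (wordV u ++ (w ++ wordV w))).
  rewrite -{1}[wordV u]cats0; apply: word_eqv_cat2l.
  exact/WordSym/word_eqv_mulwV.
rewrite catA -[X in eqv _ X]/([::] ++ wordV w); apply: word_eqv_cat2r.
apply: WordTrans (word_eqv_mulVw u); apply: word_eqv_cat2l; exact: WordSym.
Qed.

Definition word_eqvb (u w : word S) : bool := `[< eqv u w >].

Lemma word_eqvb_refl : reflexive word_eqvb.
Proof. by move=> w; apply/asboolP; exact: WordRefl. Qed.

Lemma word_eqvb_sym : symmetric word_eqvb.
Proof.
by move=> u w; apply/idP/idP => /asboolP uw; apply/asboolP; exact: WordSym.
Qed.

Lemma word_eqvb_trans : transitive word_eqvb.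
Proof.
move=> v u w /asboolP uv /asboolP vw; apply/asboolP; exact: WordTrans uv vw.
Qed.

Definition word_equiv := EquivRel _ word_eqvb_refl word_eqvb_sym word_eqvb_trans.

Definition presented := {eq_quot word_equiv}%qT.

HB.instance Definition _ := Choice.on presented.
HB.instance Definition _ := Quotient.on presented.

Definition wclass (w : word S) : presented := (\pi_presented w)%qT.

Lemma wclassP u w : wclass u = wclass w <-> eqv u w.
Proof.
rewrite /wclass; split=> [/eqquotP /asboolP //|uw].
by apply/eqquotP; apply/asboolP.
Qed.

Lemma wclass_repr x : wclass (repr x) = x.
Proof. exact: reprK. Qed.

Lemma repr_wclass w : eqv (repr (wclass w)) w.
Proof. by apply/wclassP; rewrite wclass_repr. Qed.

Definition pmul (x y : presented) := wclass (repr x ++ repr y).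
Definition pinv (x : presented) := wclass (wordV (repr x)).
Definition pone := wclass [::].

Lemma pmulE u w : pmul (wclass u) (wclass w) = wclass (u ++ w).
Proof. by apply/wclassP; apply: word_eqv_cat; exact: repr_wclass. Qed.

Lemma pinvE w : pinv (wclass w) = wclass (wordV w).
Proof. by apply/wclassP; apply: word_eqvV; exact: repr_wclass. Qed.

Fact pmulA : associative pmul.
Proof.
move=> x y z; rewrite -(wclass_repr x) -(wclass_repr y) -(wclass_repr z).
by rewrite !pmulE catA.
Qed.
Fact pmul1 : left_id pone pmul.
Proof. by move=> x; rewrite -(wclass_repr x) pmulE. Qed.
Fact pmulx1 : right_id pone pmul.
Proof. by move=> x; rewrite -(wclass_repr x) pmulE cats0. Qed.
Fact pmulV : left_inverse pone pinv pmul.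
Proof.
move=> x; rewrite -(wclass_repr x) pinvE pmulE; apply/wclassP.
exact: word_eqv_mulVw.
Qed.
Fact pmulxV : right_inverse pone pinv pmul.
Proof.
move=> x; rewrite -(wclass_repr x) pinvE pmulE; apply/wclassP.
exact: word_eqv_mulwV.
Qed.

HB.instance Definition _ :=
  isGroup.Build presented pmulA pmul1 pmulx1 pmulV pmulxV.

End PresentedGroup.

Definition free_group (S : choiceType) : groupType :=
  presented (fun _ : word S => False).

(** The group structure of a finite function type is the componentwise one. *)
Definition F2pow (n : nat) : groupType := {ffun 'I_n -> free_group 'I_2}.

Record sgraph := SGraph {
  vertex :> finType;
  adj : rel vertex;
  adj_sym : symmetric adj;
  adj_irrefl : irreflexive adj }.

Definition raag_rel (Gm : sgraph) (r : word Gm) : Prop :=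
  exists u v : Gm, adj u v /\
    r = [:: (u, true); (v, true); (u, false); (v, false)].

Definition raag (Gm : sgraph) : groupType := presented (@raag_rel Gm).

Section BestvinaBrady.
Variable Gm : sgraph.

Definition expsum (w : word Gm) : int :=
  \sum_(l <- w) (if l.2 then 1 else -1).

Lemma expsum_cat u w : expsum (u ++ w) = expsum u + expsum w.
Proof. exact: big_cat. Qed.

Lemma expsum_eqv u w : word_eqv (@raag_rel Gm) u w -> expsum u = expsum w.
Proof.
elim=> {u w} [//|u w _ -> //|x u w _ -> _ -> //|u w x b|u w r [a [c [_ ->]]]].
  rewrite !expsum_cat; congr (_ + _).
  by rewrite /expsum !big_cons /= addrA; case: b; rewrite ?subrr ?addNr add0r.
rewrite !expsum_cat; congr (_ + _); rewrite /expsum !big_cons big_nil /=.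
by rewrite addr0 addrA addrACA subrr add0r.
Qed.

(** The homomorphism to [int] sending every standard generator to [1]. *)
Definition height (x : raag Gm) : int := expsum (repr (x : presented _)).

Lemma height_wclass w : height (wclass (@raag_rel Gm) w) = expsum w.
Proof. exact/expsum_eqv/repr_wclass. Qed.

Lemma height_gen (v : Gm) : height (wclass (@raag_rel Gm) [:: (v, true)]) = 1.
Proof. by rewrite height_wclass /expsum big_seq1. Qed.

Lemma heightM x y : height (x * y)%g = height x + height y.
Proof.
rewrite -(wclass_repr x) -(wclass_repr y).
by rewrite [(_ * _)%g]pmulE !height_wclass expsum_cat.
Qed.

Definition height_ker : pred (raag Gm) := [pred x | height x == 0].

Fact height_ker_closed : group_closed height_ker.
Proof.
have height1 : height 1%g = 0 by rewrite [LHS](height_wclass [::]) /expsum big_nil.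
split=> [|x y /eqP x0 /eqP y0]; first exact/eqP.
by apply/eqP; rewrite -[LHS]addr0 -[X in _ + X]y0 -heightM mulgVK.
Qed.

Record bestvina_brady : Type := BestvinaBrady {
  bb_val :> raag Gm;
  bb_valP : height_ker bb_val }.

HB.instance Definition _ := [isSub for bb_val].
HB.instance Definition _ := [Choice of bestvina_brady by <:].
HB.instance Definition _ :=
  SubChoice_isSubGroup.Build _ _ bestvina_brady height_ker_closed.

End BestvinaBrady.

Section Evaluation.
Variable G : groupType.

Definition eval_word (S : Type) (gen : S -> G) (w : word S) : G :=
  (\prod_(l <- w) (if l.2 then gen l.1 else (gen l.1)^-1))%g.

Lemma eval_word_cat (S : Type) (gen : S -> G) u w :
  eval_word gen (u ++ w) = (eval_word gen u * eval_word gen w)%g.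
Proof. exact: big_cat. Qed.

Lemma eval_wordV (S : Type) (gen : S -> G) w :
  eval_word gen (wordV w) = (eval_word gen w)^-1%g.
Proof.
elim: w => [|[x b] w IHw]; first by rewrite /eval_word /wordV /= !big_nil invg1.
rewrite /wordV /= rev_cons -cats1 eval_word_cat -/(wordV w) IHw.
rewrite /eval_word big_seq1 big_cons invgM /=; congr (_ * _)%g.
by case: b; rewrite //= invgK.
Qed.

End Evaluation.

Record gen_family (G : groupType) := GenFamily {
  gf_size : nat;
  gf_elt : 'I_gf_size -> G;
  gf_gen : forall g, exists w, eval_word gf_elt w = g }.
Arguments gf_elt {G} _ _.

Section WordLength.
Variables (G : groupType) (S : gen_family G).

Definition word_length_spec (g : G) (n : nat) : Prop :=
  exists2 w, size w = n & eval_word (gf_elt S) w = g.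

Definition word_length (g : G) : nat := odflt 0%N (least (word_length_spec g)).

Lemma word_lengthP g : word_length_spec g (word_length g).
Proof.
rewrite /word_length /least; case: pselect => [ex|[]] /=.
  by case: ex_minnP => n /asboolP.
by have [w wg] := gf_gen S g; exists (size w); apply/asboolP; exists w.
Qed.

Lemma word_length_le w : (word_length (eval_word (gf_elt S) w) <= size w)%N.
Proof.
rewrite /word_length /least; case: pselect => [ex|[]] /=.
  by case: ex_minnP => n _ min; apply: min; apply/asboolP; exists w.
by exists (size w); apply/asboolP; exists w.
Qed.

End WordLength.
Arguments word_lengthP {G} S g.
Arguments word_length_le {G} S w.

(** An alias of [G], so that each generating family induces its own metric. *)
Definition word_space (R : realType) (G : groupType) (S : gen_family G) : Type := G.

Section WordMetric.
Variables (R : realType) (G : groupType) (S : gen_family G).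
Local Notation T := (word_space R S).

HB.instance Definition _ := Choice.copy T G.

Definition word_dist (x y : T) : R :=
  (word_length S ((x : G)^-1 * (y : G))%g)%:R.

Fact word_distxx x : word_dist x x = 0.
Proof.
rewrite /word_dist mulVg; have := word_length_le S [::].
by rewrite /eval_word big_nil leqn0 => /eqP ->.
Qed.

Fact word_dist_positivity x y : word_dist x y = 0 -> x = y.
Proof.
rewrite /word_dist => /eqP; rewrite pnatr_eq0 => /eqP l0.
have [w] := word_lengthP S ((x : G)^-1 * (y : G))%g; rewrite l0.
move=> /size0nil ->; rewrite /eval_word big_nil => /esym xy.
by rewrite -[RHS](mulVKg (x : G)) xy mulg1.
Qed.

Fact word_dist_sym x y : word_dist x y = word_dist y x.
Proof.
suff le g : (word_length S g^-1 <= word_length S g)%N.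
  have leV (a b : G) : (word_length S (a^-1 * b) <= word_length S (b^-1 * a))%N.
    by have := le (b^-1 * a)%g; rewrite invgM invgK.
  by rewrite /word_dist; congr _%:R; apply/anti_leq; rewrite !leV.
have [w <- <-] := word_lengthP S g; rewrite -eval_wordV.
by apply: leq_trans (word_length_le _ _) _; rewrite size_rev size_map.
Qed.

Fact word_dist_triangle y x z : word_dist x z <= word_dist x y + word_dist y z.
Proof.
rewrite /word_dist -natrD ler_nat.
have [u us uE] := word_lengthP S ((x : G)^-1 * (y : G))%g.
have [w ws wE] := word_lengthP S ((y : G)^-1 * (z : G))%g.
have -> : ((x : G)^-1 * (z : G) = eval_word (gf_elt S) (u ++ w))%g.
  by rewrite eval_word_cat uE wE -mulgA mulVKg.
by rewrite -us -ws -size_cat word_length_le.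
Qed.

HB.instance Definition _ := isMetric.Build R T
  word_distxx word_dist_positivity word_dist_sym word_dist_triangle.

End WordMetric.

Definition coarse_embedding (R : realType) (A B : metricType R) (f : A -> B) : Prop :=
  exists rho_m rho_p : R -> R,
    [/\ forall t, 0 <= t -> 0 <= rho_m t /\ 0 <= rho_p t,
        rho_m t @[t --> +oo] --> +oo
      & forall x y, rho_m (mdist x y) <= mdist (f x) (f y) <= rho_p (mdist x y)].

(** Two word metrics on the same group are bi-Lipschitz equivalent, so that the
    choice of the generating families is immaterial. *)
Definition coarsely_embeds (R : realType) (G H : groupType) : Prop :=
  exists (S : gen_family G) (T : gen_family H) (f : word_space R S -> word_space R T),
    coarse_embedding f.

(** [asdim X <= n]: at every scale [r], [X] is covered by [n + 1] uniformly
    bounded [r]-disjoint families. *)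
Definition asdim_le (R : realType) (X : metricType R) (n : nat) : Prop :=
  forall r : R, 0 < r -> exists (D : R) (U : 'I_n.+1 -> set (set X)),
    [/\ forall x, exists i, exists2 A, U i A & A x,
        forall i A, U i A -> forall x y, A x -> A y -> mdist x y <= D
      & forall i A B, U i A -> U i B -> A <> B ->
          forall x y, A x -> B y -> r < mdist x y].

(** [None] stands for an infinite asymptotic dimension. *)
Definition asdim (R : realType) (X : metricType R) : option nat :=
  least (@asdim_le R X).

Record fin_presentation (G : groupType) := FinPresentation {
  fp_rank : nat;
  fp_gen : 'I_fp_rank -> G;
  fp_rels : seq (word 'I_fp_rank);
  fp_surj : forall g, exists w, eval_word fp_gen w = g;
  fp_ker : forall u w, eval_word fp_gen u = eval_word fp_gen w <->
    word_eqv (fun r => r \in fp_rels) u w }.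

Arguments fp_gen {G} _ _.
Arguments fp_rels {G} _.

Definition finitely_presented (G : groupType) : Prop :=
  exists _ : fin_presentation G, True.

Section Dehn.
Variables (G : groupType) (P : fin_presentation G).
Local Notation I := 'I_(fp_rank P).

(** [w] is equal, in the free group, to a product of [N] conjugates of relators
    and of inverses of relators. *)
Definition area_spec (w : word I) (N : nat) : Prop :=
  exists l : seq (word I * word I * bool),
    [/\ size l = N, all (fun t => t.1.2 \in fp_rels P) l
      & word_eqv (fun=> False) w (flatten
          [seq t.1.1 ++ (if t.2 then t.1.2 else wordV t.1.2) ++ wordV t.1.1 | t <- l])].

Definition area (w : word I) : nat := odflt 0%N (least (area_spec w)).

Definition dehn (n : nat) : nat :=
  \max_(m < n.+1) \max_(w : m.-tuple (I * bool) | eval_word (fp_gen P) w == 1%g)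
    area w.

End Dehn.

(** The additive linear term makes the relation independent of the presentation. *)
Definition dehn_dominated (f g : nat -> nat) : Prop :=
  exists C : nat, forall n, (f n <= C * g (C * n + C) + C * n + C)%N.

Definition dehn_equivalent (f g : nat -> nat) : Prop :=
  dehn_dominated f g /\ dehn_dominated g f.

Section HomologicalFiniteness.
Variable G : groupType.

(** A left module over the integral group ring of [G], presented as an abelian
    group with a linear action of [G]. *)
Record gmodule := GModule {
  gm_sort :> zmodType;
  gm_act : G -> gm_sort -> gm_sort;
  gm_act1 : forall m, gm_act 1%g m = m;
  gm_actM : forall g h m, gm_act (g * h)%g m = gm_act g (gm_act h m);
  gm_actD : forall g m m', gm_act g (m + m') = gm_act g m + gm_act g m' }.

Definition trivial_gmodule : gmodule :=
  @GModule int (fun _ m => m) (fun=> erefl) (fun _ _ _ => erefl) (fun _ _ _ => erefl).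

Definition gm_hom (M N : gmodule) (f : M -> N) : Prop :=
  (forall m m', f (m + m') = f m + f m') /\ (forall g m, f (gm_act g m) = gm_act g (f m)).

Definition gm_projective (P : gmodule) : Prop :=
  forall (M N : gmodule) (p : M -> N) (f : P -> N),
    gm_hom p -> (forall y, exists x, p x = y) -> gm_hom f ->
    exists2 h : P -> M, gm_hom h & forall x, p (h x) = f x.

Definition gm_fin_gen (M : gmodule) : Prop :=
  exists (k : nat) (e : 'I_k -> M), forall m, exists l : seq (int * G * 'I_k),
    m = \sum_(t <- l) gm_act t.1.2 (e t.2) *~ t.1.1.

Definition type_FP (n : nat) : Prop :=
  exists (P : nat -> gmodule) (d : forall i, P i.+1 -> P i)
      (eps : P 0%N -> trivial_gmodule),
    [/\ [/\ forall i, gm_hom (d i), gm_hom eps & forall z, exists x, eps x = z],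
        forall x, eps x = 0 <-> exists y, d 0%N y = x,
        forall i x, d i x = 0 <-> exists y, d i.+1 y = x,
        forall i, gm_projective (P i)
      & forall i, (i <= n)%N -> gm_fin_gen (P i)].

End HomologicalFiniteness.

Section CWComplexes.
Variable R : realType.

Definition disk n : set 'rV[R]_n := [set x | \sum_i x ord0 i ^+ 2 <= 1].
Definition open_disk n : set 'rV[R]_n := [set x | \sum_i x ord0 i ^+ 2 < 1].
Definition sphere n : set 'rV[R]_n := [set x | \sum_i x ord0 i ^+ 2 = 1].

(** The CW structures on a Hausdorff space, described by characteristic maps as in
    Hatcher, Algebraic Topology, Proposition A.2.  The values of a characteristic
    map outside of the closed disk are irrelevant. *)
Record cw_complex := CWComplex {
  cw_space :> topologicalType;
  cw_cell : nat -> Type;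
  cw_map : forall n, cw_cell n -> 'rV[R]_n -> cw_space;
  cw_open_cell (e : {n & cw_cell n}) : set cw_space :=
    cw_map (projT2 e) @` @open_disk (projT1 e);
  cw_hausdorff : hausdorff_space cw_space;
  cw_continuous : forall n (e : cw_cell n), {within @disk n, continuous (cw_map e)};
  cw_inj : forall n (e : cw_cell n), set_inj (@open_disk n) (cw_map e);
  cw_partition : forall x, exists! e, cw_open_cell e x;
  cw_boundary : forall n (e : cw_cell n), exists F : set {m & cw_cell m},
    [/\ finite_set F, forall c, F c -> (projT1 c < n)%N
      & cw_map e @` @sphere n `<=` \bigcup_(c in F) cw_open_cell c];
  cw_weak : forall A : set cw_space,
    closed A <-> forall n (e : cw_cell n), closed (@disk n `&` cw_map e @^-1` A) }.

Section Homotopy.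
Variable X : topologicalType.

Definition I01 : set R := `[0, 1]%classic.

Definition path_connected_space : Prop :=
  forall x y : X, exists2 p : R -> X,
    {within I01, continuous p} & p 0 = x /\ p 1 = y.

Definition is_loop (x0 : X) (p : R -> X) : Prop :=
  [/\ {within I01, continuous p}, p 0 = x0 & p 1 = x0].

Definition loop_cat (p q : R -> X) : R -> X :=
  fun t => if t <= 2^-1 then p (2 * t) else q (2 * t - 1).

Definition loop_homotopic (x0 : X) (p q : R -> X) : Prop :=
  exists2 H : R * R -> X, {within I01 `*` I01, continuous H} &
    [/\ forall t, I01 t -> H (0, t) = p t,
        forall t, I01 t -> H (1, t) = q t
      & forall s, I01 s -> H (s, 0) = x0 /\ H (s, 1) = x0].

(** [phi] sends a loop to the image of its class under an isomorphism from the
    fundamental group to [G]; its values at other functions are irrelevant. *)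
Definition pi1_isomorphic (x0 : X) (G : groupType) : Prop :=
  exists phi : (R -> X) -> G,
    [/\ forall p q, is_loop x0 p -> is_loop x0 q ->
          phi (loop_cat p q) = (phi p * phi q)%g,
        forall p q, is_loop x0 p -> is_loop x0 q ->
          phi p = phi q <-> loop_homotopic x0 p q
      & forall g, exists2 p, is_loop x0 p & phi p = g].

Definition cube n : set 'rV[R]_n := [set x | forall i, 0 <= x ord0 i <= 1].
Definition cube_bd n : set 'rV[R]_n :=
  [set x | cube x /\ exists i, x ord0 i = 0 \/ x ord0 i = 1].

(** Triviality of the [n]-th homotopy group at [x0], whose elements are the classes,
    relative to the boundary, of the maps of pairs from [(I^n, bd I^n)] to [(X, x0)]. *)
Definition pi_trivial (n : nat) (x0 : X) : Prop :=
  forall f : 'rV[R]_n -> X, {within @cube n, continuous f} ->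
    (forall x, cube_bd x -> f x = x0) ->
    exists2 H : R * 'rV[R]_n -> X, {within I01 `*` @cube n, continuous H} &
      [/\ forall x, cube x -> H (0, x) = f x,
          forall x, cube x -> H (1, x) = x0
        & forall s x, I01 s -> cube_bd x -> H (s, x) = x0].

Definition eilenberg_maclane1 (G : groupType) : Prop :=
  path_connected_space /\ exists x0 : X,
    pi1_isomorphic x0 G /\ forall n, (2 <= n)%N -> pi_trivial n x0.

End Homotopy.

Definition type_F (G : groupType) (n : nat) : Prop :=
  exists X : cw_complex, eilenberg_maclane1 X G /\
    forall i, (i <= n)%N -> finite_set [set: cw_cell X i].

End CWComplexes.

(* Main.v *)
Require Import Defs.
From HB Require Import structures.
From mathcomp Require Import all_boot all_order all_algebra.
From mathcomp Require Import all_classical all_reals all_analysis.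
From mathcomp Require Import zify ring lra.
From mathcomp Require Import freeg.

(** Let [star k] be the star with [k] leaves.  Its Artin group is the product of the free group on the
    leaves and of the center, and its Bestvina-Brady group is free on the [k] elements (leaf)(center)^-1.
    The graphs [star 1] and [star 2] therefore give the groups Z and F_2.  Both have linear Dehn
    functions and asymptotic dimension 1, and both have a finite classifying space, a rose; but F_2 does
    not coarsely embed in Z because it has exponential growth.

    The rose is shown to be aspherical by means of its universal cover, the Cayley tree of the free
    group.  As a set the cover is [G * rose], and its metric comes from the reduced word that leads from
    [1] to a point; small moves in the rose lift uniquely, and sliding points along geodesics to [1]
    contracts the tree. *)

Set Implicit Arguments.
Unset Strict Implicit.
Unset Printing Implicit Defensive.

Import Order.TTheory GRing.Theory Num.Theory.
Import numFieldNormedType.Exports.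

Local Open Scope classical_set_scope.
Local Open Scope ring_scope.

(** * Reduced words and free bases *)

(** The lemmas are stated for any group with a [free_basis], that is, a normal form for its
    elements, so that both Bestvina-Brady groups and $F_2^1$ are covered at once; word metrics of
    arbitrary generating families are then compared with the distance given by normal forms. The
    cover is built by hand because an Eilenberg-MacLane space has to come with actual lifts and
    homotopies. Two facts do the work of a covering topology: a move of length [d] in the rose lifts
    at every sheet to a move of length at most [d] ([holonomy]), and distinct points of one fiber
    are at least 1/2 apart ([fiber_dist]). The constants 1/4, 1/8 and 1/16 of the lifting lemmas
    keep accumulated errors below this 1/2. *)

Section ReducedWords.
Variable S : choiceType.
Implicit Types (l m : S * bool) (u v w : word S).

Definition flip l : S * bool := (l.1, ~~ l.2).

Lemma flipK : involutive flip.
Proof. by case=> x b; rewrite /flip /= negbK. Qed.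

Lemma flip_eqC l m : (flip l == m) = (l == flip m).
Proof. by apply/eqP/eqP => [<-|->]; rewrite flipK. Qed.

Definition compat l m := m != flip l.

Definition reduced w := sorted compat w.

Definition push l w :=
  if w is m :: w' then if m == flip l then w' else l :: w else [:: l].

Definition red w := foldr push [::] w.

Lemma reduced_push l w : reduced w -> reduced (push l w).
Proof.
case: w => //= m w mw; case: ifPn => [_|nl]; first exact: path_sorted mw.
by rewrite /= /compat nl.
Qed.

Lemma reduced_red w : reduced (red w).
Proof. by elim: w => //= l w; exact: reduced_push. Qed.

Lemma red_id w : reduced w -> red w = w.
Proof.
elim: w => //= l w IHw lw; rewrite IHw; last exact: path_sorted lw.
by case: w lw {IHw} => //= m w /andP[/negbTE ->].
Qed.

(** Van der Waerden's trick: a letter and its inverse act on reduced words by mutually inverse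
    permutations, which makes [red] constant on classes of free equivalence. *)
Lemma pushK l w : reduced w -> push l (push (flip l) w) = w.
Proof.
case: w => [_|m w] /=; first by rewrite eqxx.
rewrite flipK; case: eqVneq => [->|ml] mw /=; last by rewrite eqxx.
case: w mw => //= a w /andP[la _].
by rewrite (negbTE la).
Qed.

Lemma red_cat u w : red (u ++ w) = foldr push (red w) u.
Proof. by rewrite /red foldr_cat. Qed.

Lemma red_eqv u w : word_eqv (fun=> False) u w -> red u = red w.
Proof.
elim=> {u w} [//|u w _ -> //|x u w _ -> _ -> //|u w x b|//].
by rewrite !red_cat /=; congr foldr; apply: (@pushK (x, b)); exact: reduced_red.
Qed.

Lemma word_eqv_red (rels : word S -> Prop) w : word_eqv rels w (red w).
Proof.
elim: w => [|[x b] w IHw] /=; first exact: WordRefl.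
apply: (@WordTrans _ _ ((x, b) :: red w)).
  by rewrite -cat1s -[X in word_eqv _ _ X]cat1s; exact: word_eqv_cat2l.
case: (red w) => [|m v] /=; first exact: WordRefl.
case: eqVneq => [->|_]; last exact: WordRefl.
exact: (@WordCancel _ _ [::]).
Qed.

Lemma wordV_map w : wordV w = rev (map flip w).
Proof. by []. Qed.

Lemma size_wordV w : size (wordV w) = size w.
Proof. by rewrite /wordV size_rev size_map. Qed.

Lemma reduced_wordV w : reduced (wordV w) = reduced w.
Proof.
rewrite /reduced wordV_map rev_sorted sorted_map.
by apply: eq_sorted => l m; rewrite /compat /= -flip_eqC flipK eq_sym flip_eqC.
Qed.

Lemma reduced_cat u w l :
  reduced (u ++ w) = [&& reduced u, reduced w &
    (nilp u || nilp w || compat (last l u) (head l w))].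
Proof.
case: u => [|a u] /=; first by rewrite andbT.
rewrite /reduced /= cat_path; case: w => [|b w] /=; first by rewrite !andbT.
by congr (_ && _); rewrite andbC.
Qed.

Lemma reduced_take n w : reduced w -> reduced (take n w).
Proof. exact: take_sorted. Qed.

Lemma reduced_rcons w l :
  reduced (rcons w l) = reduced w && (nilp w || compat (last l w) l).
Proof. by rewrite -cats1 (reduced_cat _ _ l) /= orbF. Qed.

Fixpoint lcp u v : nat :=
  match u, v with
  | a :: u', b :: v' => if a == b then (lcp u' v').+1 else 0%N
  | _, _ => 0%N
  end.

Lemma leq_lcp n u v : (n <= lcp u v)%N =
  [&& n <= size u, n <= size v & take n u == take n v]%N.
Proof.
elim: n u v => [|n IHn] [|a u] [|b v] //=.
  by rewrite andbF.
rewrite eqseq_cons; case: (eqVneq a b) => _; first by rewrite !ltnS IHn.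
by rewrite /= !andbF.
Qed.

Lemma lcpC u v : lcp u v = lcp v u.
Proof. by elim: u v => [|a u IHu] [|b v] //=; rewrite eq_sym IHu. Qed.

Lemma lcp_leql u v : (lcp u v <= size u)%N.
Proof. by have := leqnn (lcp u v); rewrite {2}/is_true leq_lcp => /and3P[]. Qed.

Lemma lcp_leqr u v : (lcp u v <= size v)%N.
Proof. by rewrite lcpC lcp_leql. Qed.

Lemma take_lcp u v : take (lcp u v) u = take (lcp u v) v.
Proof. by have := leqnn (lcp u v); rewrite leq_lcp => /and3P[_ _ /eqP]. Qed.

Lemma lcpuu u : lcp u u = size u.
Proof. by elim: u => //= a u ->; rewrite eqxx. Qed.

(** This is the 0-hyperbolicity of the Cayley tree, and the source of the triangle inequality for
    [tree_dist]. *)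
Lemma lcp_ultra u v w : (minn (lcp u v) (lcp v w) <= lcp u w)%N.
Proof.
rewrite leq_lcp.
have /[!leq_lcp] /and3P[-> _ /eqP ->] := geq_minl (lcp u v) (lcp v w).
by have /[!leq_lcp] /and3P[_ -> ->] := geq_minr (lcp u v) (lcp v w).
Qed.

Lemma lcp_eq u v : lcp u v = size u -> lcp u v = size v -> u = v.
Proof. by move=> eu ev; have := take_lcp u v; rewrite {1}eu ev !take_size. Qed.

(** The last hypothesis says that [w] is the longest common prefix, so [u] and [v] start with
    different letters and nothing cancels at the junction. *)
Lemma reduced_wordV_cat u v w :
  reduced (w ++ u) -> reduced (w ++ v) -> lcp (w ++ u) (w ++ v) = size w ->
  reduced (wordV u ++ v).
Proof.
case: u => [|a u]; case: v => [|b v]; rewrite ?cats0 //=.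
- by rewrite /wordV /= => _; rewrite (reduced_cat _ _ b) => /and3P[].
- by rewrite (reduced_cat _ _ a) => /and3P[_ + _]; rewrite -reduced_wordV.
rewrite (reduced_cat w (a :: u) a) => /and3P[_ ru _].
rewrite (reduced_cat w (b :: v) b) => /and3P[_ rv _] E.
rewrite (reduced_cat _ _ b) reduced_wordV ru rv /=; apply/orP; right.
rewrite wordV_cons last_cat /= /compat /flip /= negbK -surjective_pairing.
apply: contra_eq_neq E => ->; elim: w => /= [|c w IHw]; first by rewrite eqxx.
by rewrite eqxx eqSS.
Qed.

End ReducedWords.

(** A basis of the free group [G], given by the normal form of its elements. *)
Record free_basis (G : groupType) (k : nat) := FreeBasis {
  fb_elt : 'I_k -> G;
  fb_nf : G -> word 'I_k;
  fb_nfK : forall g, eval_word fb_elt (fb_nf g) = g;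
  fb_reduced : forall g, reduced (fb_nf g);
  fb_nf_eval : forall w, reduced w -> fb_nf (eval_word fb_elt w) = w }.

Lemma eval_word_nil (G : groupType) (S : Type) (f : S -> G) :
  eval_word f [::] = 1%g.
Proof. exact: big_nil. Qed.

Lemma eval_word_cons (G : groupType) (S : Type) (f : S -> G) l w :
  eval_word f (l :: w) = ((if l.2 then f l.1 else (f l.1)^-1) * eval_word f w)%g.
Proof. exact: big_cons. Qed.

Lemma eval_word_seq1 (G : groupType) (S : Type) (f : S -> G) l :
  eval_word f [:: l] = (if l.2 then f l.1 else (f l.1)^-1)%g.
Proof. exact: big_seq1. Qed.

Lemma eval_word_rcons (G : groupType) (S : Type) (f : S -> G) w l :
  eval_word f (rcons w l) = (eval_word f w * if l.2 then f l.1 else (f l.1)^-1)%g.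
Proof. by rewrite -cats1 eval_word_cat eval_word_seq1. Qed.

Lemma eval_word_eqv (G : groupType) (S : Type) (f : S -> G) rels u w :
    (forall r, rels r -> eval_word f r = 1%g) ->
  word_eqv rels u w -> eval_word f u = eval_word f w.
Proof.
move=> rel1; elim=> {u w} [//|u w _ -> //|x u w _ -> _ -> //|u w x b|u w r Rr].
  rewrite !eval_word_cat; congr (_ * _)%g.
  by rewrite !eval_word_cons; case: b; rewrite /= ?mulVKg ?mulKg.
by rewrite !eval_word_cat (rel1 r) ?mul1g.
Qed.

Lemma eval_word_red (G : groupType) (S : choiceType) (f : S -> G) w :
  eval_word f (red w) = eval_word f w.
Proof.
by apply/esym/(@eval_word_eqv _ _ f (fun=> False)) => //; exact: word_eqv_red.
Qed.

Definition word_subst (S S' : Type) (f : S -> word S') (w : word S) : word S' :=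
  flatten [seq if l.2 then f l.1 else wordV (f l.1) | l <- w].

Lemma word_subst_cat (S S' : Type) (f : S -> word S') u w :
  word_subst f (u ++ w) = word_subst f u ++ word_subst f w.
Proof. by rewrite /word_subst map_cat flatten_cat. Qed.

Lemma eval_word_subst (G : groupType) (S S' : choiceType) (e : S' -> G)
    (f : S -> word S') w :
  eval_word e (word_subst f w) = eval_word (fun x => eval_word e (f x)) w.
Proof.
elim: w => [|l w IHw]; first by rewrite !eval_word_nil.
rewrite [LHS]eval_word_cat IHw eval_word_cons; congr (_ * _)%g.
by case: l.2; rewrite ?eval_wordV.
Qed.

Lemma word_subst_eqv (S S' : choiceType) (rels : word S' -> Prop) (f : S -> word S') u w :
  word_eqv (fun=> False) u w -> word_eqv rels (word_subst f u) (word_subst f w).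
Proof.
elim=> {u w} [w|u w _|x u w _ ux _ xw|u w x b|//].
- exact: WordRefl.
- exact: WordSym.
- exact: WordTrans ux xw.
rewrite !word_subst_cat; apply: word_eqv_cat2l.
rewrite /word_subst /= catA -[X in word_eqv _ _ X]cat0s; apply: word_eqv_cat2r.
by case: b => /=; [exact: word_eqv_mulwV|exact: word_eqv_mulVw].
Qed.

Section FreeBasisTheory.
Variables (G : groupType) (k : nat) (B : free_basis G k).
Local Notation ev := (eval_word (fb_elt B)).
Local Notation nf := (fb_nf B).
Implicit Types (g h : G) (w : word 'I_k).

Lemma fb_nf_red w : nf (ev w) = red w.
Proof. by rewrite -eval_word_red fb_nf_eval //; exact: reduced_red. Qed.

Lemma fb_nf_inj : injective nf.
Proof. exact: can_inj (fb_nfK B). Qed.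

Lemma fb_nf1 : nf 1%g = [::].
Proof. by rewrite -(eval_word_nil (fb_elt B)) fb_nf_red. Qed.

Lemma fb_eqvP u w : ev u = ev w <-> word_eqv (fun=> False) u w.
Proof.
split=> [uw|]; last exact: eval_word_eqv.
apply: (@WordTrans _ _ (red u)); first exact: word_eqv_red.
by rewrite -fb_nf_red uw fb_nf_red; apply: WordSym; exact: word_eqv_red.
Qed.

Definition fb_dist g h : nat := size (nf (g^-1 * h)%g).

Lemma fb_nfVM g h : exists2 p, nf g = p ++ drop (size p) (nf g) /\
    nf h = p ++ drop (size p) (nf h) &
  size p = lcp (nf g) (nf h) /\
  nf (g^-1 * h)%g = wordV (drop (size p) (nf g)) ++ drop (size p) (nf h).
Proof.
set u := nf g; set v := nf h; pose p := take (lcp u v) u.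
have sp : size p = lcp u v by rewrite size_take_min (minn_idPl (lcp_leql _ _)).
have eu : u = p ++ drop (size p) u by rewrite sp cat_take_drop.
have evv : v = p ++ drop (size p) v by rewrite sp /p take_lcp cat_take_drop.
exists p => //; split=> //.
have -> : (g^-1 * h)%g = ev (wordV (drop (size p) u) ++ drop (size p) v).
  rewrite eval_word_cat eval_wordV -[g in LHS](fb_nfK B) -[h in LHS](fb_nfK B).
  by rewrite -/u -/v {1}eu {1}evv !eval_word_cat invgM -mulgA mulKg.
rewrite fb_nf_eval //; apply: (@reduced_wordV_cat _ _ _ p).
- by rewrite -eu fb_reduced.
- by rewrite -evv fb_reduced.
by rewrite -eu -evv sp.
Qed.

(** The geodesics from [1] to [g] and [h] share exactly their common prefix; the equation is
    arranged so as to avoid truncated subtraction. *)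
Lemma fb_distE g h :
  (fb_dist g h + (lcp (nf g) (nf h)).*2 = size (nf g) + size (nf h))%N.
Proof.
have [p [ug vh] [<- e]] := fb_nfVM g h.
have sg : size (nf g) = (size p + size (drop (size p) (nf g)))%N by rewrite -size_cat -ug.
have sh : size (nf h) = (size p + size (drop (size p) (nf h)))%N by rewrite -size_cat -vh.
rewrite /fb_dist e size_cat size_wordV sg sh -addnn.
by move: (size p) (size _) (size _) => a b c; lia.
Qed.

Lemma fb_nf_size w : (size (nf (ev w)) <= size w)%N.
Proof.
rewrite fb_nf_red; elim: w => //= l w IHw; rewrite /push.
case: (red w) IHw => //= m v IHw; case: ifP => _ //=.
exact: leqW (ltnW IHw).
Qed.

Lemma fb_nfM_size g h : (size (nf (g * h)%g) <= size (nf g) + size (nf h))%N.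
Proof.
by rewrite -{1}[g](fb_nfK B) -{1}[h](fb_nfK B) -eval_word_cat -size_cat fb_nf_size.
Qed.

Lemma fb_nfV g : nf (g^-1)%g = wordV (nf g).
Proof.
by rewrite -{1}[g](fb_nfK B) -eval_wordV fb_nf_eval // reduced_wordV fb_reduced.
Qed.

End FreeBasisTheory.

(** The normal form of [g] is the reduction of an arbitrarily chosen word for [g]; without
    relations, two words for [g] are freely equivalent and reduce alike. *)
Lemma free_basis_of (G : groupType) k (x : 'I_k -> G) :
    (forall g, exists w, eval_word x w = g) ->
    (forall w, eval_word x w = 1%g -> word_eqv (fun=> False) w [::]) ->
  free_basis G k.
Proof.
move=> surj inj; have [f fE] := choice surj.
refine (@FreeBasis G k x (fun g => red (f g)) _ _ _) => [g|g|w rw] /=.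
- by rewrite eval_word_red.
- exact: reduced_red.
rewrite -[RHS](red_id rw); apply: red_eqv.
have e : eval_word x (f (eval_word x w) ++ wordV w) = 1%g.
  by rewrite eval_word_cat fE eval_wordV mulgV.
have {}e := inj _ e.
set v := f _ in e *.
apply: (@WordTrans _ _ (v ++ (wordV w ++ w))).
  rewrite -{1}[v]cats0; apply: word_eqv_cat2l; apply: WordSym.
  exact: word_eqv_mulVw.
by rewrite catA -[X in word_eqv _ _ X]cat0s; apply: word_eqv_cat2r.
Qed.

(** * The Bestvina-Brady group of a star *)

Lemma wclass_eval (S : choiceType) (rels : word S -> Prop) u :
  wclass rels u = eval_word (fun v => wclass rels [:: (v, true)]) u :> presented rels.
Proof.
elim: u => [|[v b] u IHu]; first by rewrite eval_word_nil.
rewrite eval_word_cons -IHu -cat1s; case: b => /=.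
  by rewrite [RHS]pmulE.
have -> : ((wclass rels [:: (v, true)])^-1 = wclass rels [:: (v, false)] :> presented rels)%g.
  by rewrite [LHS]pinvE.
by rewrite [RHS]pmulE.
Qed.

Section Star.
Variable k : nat.

Definition star_adj : rel (option 'I_k) := fun u v => (u == None) (+) (v == None).

Fact star_adj_sym : symmetric star_adj.
Proof. by move=> u v; rewrite /star_adj addbC. Qed.

Fact star_adj_irrefl : irreflexive star_adj.
Proof. by move=> u; rewrite /star_adj addbb. Qed.

Definition star : sgraph := SGraph star_adj_sym star_adj_irrefl.

Local Notation A := (raag star).
Local Notation cls := (wclass (@raag_rel star)).

Definition leaf_word (i : 'I_k) : word star := [:: (Some i, true); (None, false)].

Fact leaf_ker i : height_ker (cls (leaf_word i)).
Proof. by apply/eqP; rewrite height_wclass /expsum !big_cons big_nil /= addr0 subrr. Qed.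

Definition star_gen i : bestvina_brady star := BestvinaBrady (leaf_ker i).

Lemma bb_val_eval (w : word 'I_k) :
  bb_val (eval_word star_gen w) = cls (word_subst leaf_word w).
Proof.
rewrite [RHS]wclass_eval eval_word_subst.
under [X in _ = eval_word X _]eq_fun do rewrite -wclass_eval.
elim: w => [|l w IHw]; first by rewrite !eval_word_nil.
by rewrite !eval_word_cons -IHw; case: l.2.
Qed.

(** Induces the retraction of the Artin group of the star onto the free group on the leaves. *)
Definition kill_center (u : word star) : word 'I_k :=
  pmap (fun l => if l.1 is Some i then Some (i, l.2) else None) u.

Lemma kill_center_eqv u w : word_eqv (@raag_rel star) u w ->
  word_eqv (fun=> False) (kill_center u) (kill_center w).
Proof.
elim=> {u w} [w|u w _|x u w _ ux _ xw|u w x b|u w r [a [c [ac ->]]]].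
- exact: WordRefl.
- exact: WordSym.
- exact: WordTrans ux xw.
- rewrite /kill_center !pmap_cat /=; case: x => [i|] /=; first exact: WordCancel.
  exact: WordRefl.
rewrite /kill_center !pmap_cat.
by case: a c ac => [i|] [j|] //= _; exact: (@WordCancel _ _ _ _ _ true).
Qed.

Lemma kill_center_leaf w : kill_center (word_subst leaf_word w) = w.
Proof.
elim: w => // -[i b] w IHw; rewrite -[in RHS]IHw.
by rewrite /kill_center /word_subst /= pmap_cat; case: b.
Qed.

(** Killing the center sends (leaf)(center)^-1 to the leaf, so it turns a relation among the
    [star_gen i] into the same relation in the free group. *)
Lemma star_gen_inj w : eval_word star_gen w = 1%g -> word_eqv (fun=> False) w [::].
Proof.
move/(congr1 (@bb_val _)); rewrite bb_val_eval => /wclassP /kill_center_eqv.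
by rewrite kill_center_leaf.
Qed.

Local Notation center := (cls [:: (None, true)] : A).

Lemma center_comm (x : A) : commute x center.
Proof.
rewrite -[x]wclass_repr; move: (repr _) => u {x}; rewrite wclass_eval.
have gencomm v : commute (cls [:: (v, true)] : A) center.
  case: v => [i|]; last by [].
  rewrite /commute [LHS]pmulE [RHS]pmulE; apply/wclassP/WordSym.
  set a := (Some i : star, true); set c := (None : star, true).
  apply: (@WordTrans _ _ ([:: a; c; flip a; flip c] ++ [:: c; a])).
    apply: WordSym; apply: (@WordRel _ _ [::] [:: c; a] [:: a; c; flip a; flip c]).
    by exists (Some i), None.
  apply: (@WordTrans _ _ [:: a; c; flip a; a]).
    exact: (@WordCancel _ _ [:: a; c; flip a] [:: a] None false).
  exact: (@WordCancel _ _ [:: a; c] [::] (Some i) false).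
elim: u => [|l u IHu]; first by rewrite eval_word_nil; rewrite /commute mul1g mulg1.
rewrite eval_word_cons; apply/commute_sym/commuteM; last exact: commute_sym.
by case: l.2; [|apply: commuteV]; apply: commute_sym.
Qed.

Lemma center_pow (u : word star) : exists n m : nat, expsum u = n%:Z - m%:Z /\
  eval_word (fun=> center) u = (center ^+ n * center ^- m)%g.
Proof.
elim: u => [|l u [n [m [eu E]]]].
  by exists 0%N, 0%N; rewrite /expsum big_nil eval_word_nil !expg0 invg1 mulg1.
rewrite /expsum big_cons -/(expsum u) eu eval_word_cons E; case: l.2.
  exists n.+1, m; split; last by rewrite mulgA expgS.
  by rewrite addrA -intS.
exists n, m.+1; split; first by rewrite -[m.+1]add1n PoszD opprD addrCA.
rewrite expgSr invgM !mulgA; congr (_ * _)%g.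
by apply: commuteX; apply: commute_sym; apply: commuteV.
Qed.

Lemma star_gen_surj (g : bestvina_brady star) : exists w, eval_word star_gen w = g.
Proof.
(* Write each leaf as (leaf)(center)^-1 times the center, and gather the central factors on the
   right. Their total exponent is the height, which vanishes on the kernel. *)
have split_word (u : word star) : cls u =
    (bb_val (eval_word star_gen (kill_center u)) * eval_word (fun=> center) u)%g.
  rewrite bb_val_eval [X in (X * _)%g]wclass_eval eval_word_subst [LHS]wclass_eval.
  elim: u => [|[v b] u IHu]; first by rewrite !eval_word_nil mulg1.
  rewrite [LHS]eval_word_cons IHu [eval_word (fun=> _) (_ :: _)]eval_word_cons.
  have comm (c : bool) (x : A) : commute x (if c then center else center^-1)%g.
    by case: c; [|apply: commuteV]; exact: center_comm.
  rewrite /kill_center /=; case: v => [i|] /=; last first.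
    by rewrite !mulgA; congr (_ * _)%g; apply/esym/comm.
  rewrite eval_word_cons /= -/(kill_center u).
  have -> : eval_word (fun v => cls [:: (v, true)]) (leaf_word i) =
      (cls [:: (Some i, true)] * center^-1)%g :> A.
    by rewrite eval_word_cons eval_word_seq1.
  rewrite !mulgA; congr (_ * _)%g; rewrite -!mulgA (comm b).
  case: b; first by rewrite !mulgA mulgVK.
  rewrite invgM invgK !mulgA; congr (_ * _)%g.
  by rewrite -(center_comm (cls [:: (Some i, true)])^-1%g) mulgK.
case: g => x x0; exists (kill_center (repr (x : presented _))); apply: val_inj => /=.
have [n [m [e E]]] := center_pow (repr (x : presented _)).
rewrite -[RHS]wclass_repr split_word E.
have /eqP nm : n == m.
  by move: x0; rewrite /height_ker /= /height e subr_eq0 eqz_nat.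
by rewrite nm mulgV mulg1.
Qed.

Definition star_basis : free_basis (bestvina_brady star) k :=
  free_basis_of star_gen_surj star_gen_inj.

End Star.

Section F2powBasis.

Definition F2pow1_gen (i : 'I_2) : F2pow 1 :=
  [ffun=> wclass (fun _ : word 'I_2 => False) [:: (i, true)]].

Lemma F2pow1_eval w i :
  eval_word F2pow1_gen w i = wclass (fun _ : word 'I_2 => False) w :> free_group 'I_2.
Proof.
rewrite wclass_eval; elim: w => [|l w IHw]; first by rewrite !eval_word_nil ffunE.
by rewrite !eval_word_cons ffunE IHw; case: l.2; rewrite ?ffunE.
Qed.

Lemma F2pow1_surj (g : F2pow 1) : exists w, eval_word F2pow1_gen w = g.
Proof.
exists (repr (g ord0 : presented _)); apply/ffunP => i.
by rewrite F2pow1_eval wclass_repr (ord1 i).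
Qed.

Lemma F2pow1_inj w : eval_word F2pow1_gen w = 1%g -> word_eqv (fun=> False) w [::].
Proof.
by move/(congr1 (fun g : F2pow 1 => g ord0)); rewrite F2pow1_eval ffunE => /wclassP.
Qed.

Definition F2pow1_basis : free_basis (F2pow 1) 2 := free_basis_of F2pow1_surj F2pow1_inj.

End F2powBasis.

(** * Finite presentations and Dehn functions *)

Section FinitePresentation.
Variables (G : groupType) (k : nat) (B : free_basis G k).

Lemma free_finitely_presented : finitely_presented G.
Proof.
have surj g : exists w, eval_word (fb_elt B) w = g by exists (fb_nf B g); exact: fb_nfK.
have ker u w : eval_word (fb_elt B) u = eval_word (fb_elt B) w <->
    word_eqv (fun r => r \in [::]) u w.
  split=> [/fb_eqvP|]; last by apply: eval_word_eqv.
  elim=> {u w} [w|u w _|x u w _ ux _ xw|u w x b|//].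
  - exact: WordRefl.
  - exact: WordSym.
  - exact: WordTrans ux xw.
  - exact: WordCancel.
by exists (FinPresentation surj ker).
Qed.

Variable P : fin_presentation G.
Local Notation I := 'I_(fp_rank P).
Local Notation evP := (eval_word (fp_gen P)).
Local Notation evB := (eval_word (fb_elt B)).
Local Notation spec := (@area_spec G P).
Local Notation feqv := (word_eqv (fun=> False)).
Implicit Types u v w : word I.

Definition conj_word (t : word I * word I * bool) : word I :=
  t.1.1 ++ (if t.2 then t.1.2 else wordV t.1.2) ++ wordV t.1.1.

Lemma area_spec_eqv u w n : feqv u w -> spec w n -> spec u n.
Proof. by move=> uw [l [sl al wl]]; exists l; split=> //; exact: WordTrans uw wl. Qed.

Lemma area_spec0 : spec [::] 0.
Proof. by exists [::]; split=> //; exact: WordRefl. Qed.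

Lemma area_specM u w m n :
  spec u m -> spec w n -> spec (u ++ w) (m + n).
Proof.
move=> [l [sl al ul]] [l' [sl' al' wl']]; exists (l ++ l').
rewrite size_cat sl sl' all_cat al al' map_cat flatten_cat; split=> //.
exact: word_eqv_cat.
Qed.

Lemma area_specV w n : spec w n -> spec (wordV w) n.
Proof.
move=> [l [sl al wl]]; exists (rev [seq (t.1, ~~ t.2) | t <- l]); split.
- by rewrite size_rev size_map.
- by rewrite all_rev all_map.
apply: WordTrans (word_eqvV wl) _; rewrite -/conj_word map_rev -map_comp.
elim: l {sl al wl} => [|[[a r] b] l IHl] /=; first exact: WordRefl.
rewrite rev_cons -cats1 flatten_cat /= cats0 wordV_cat; apply: word_eqv_cat IHl _.
rewrite /conj_word /= !wordV_cat wordVK -catA.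
by case: b => /=; rewrite ?wordVK; exact: WordRefl.
Qed.

Lemma area_spec_conj v w n : spec w n -> spec (v ++ w ++ wordV v) n.
Proof.
move=> [l [sl al wl]]; exists [seq (v ++ t.1.1, t.1.2, t.2) | t <- l]; split.
- by rewrite size_map.
- by rewrite all_map.
apply: (@WordTrans _ _ (v ++ flatten (map conj_word l) ++ wordV v)).
  by apply: word_eqv_cat2l; apply: word_eqv_cat2r.
have split_conj (c f : word I) :
    feqv (v ++ (c ++ f) ++ wordV v) ((v ++ c ++ wordV v) ++ (v ++ f ++ wordV v)).
  rewrite -!catA; do 2!apply: word_eqv_cat2l.
  rewrite [X in word_eqv _ _ X]catA -[X in word_eqv _ X _]cat0s.
  by apply: word_eqv_cat2r; apply: WordSym; exact: word_eqv_mulVw.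
rewrite -map_comp; elim: l {sl al wl} => [|t l IHl]; first exact: word_eqv_mulwV.
apply: WordTrans (split_conj _ _) _; apply: word_eqv_cat IHl.
by rewrite /conj_word /= wordV_cat -!catA; exact: WordRefl.
Qed.

Lemma area_spec_rel r : r \in fp_rels P -> spec r 1.
Proof.
move=> rP; exists [:: ([::], r, true)]; split=> //=; first by rewrite rP.
by rewrite !cats0; exact: WordRefl.
Qed.

Lemma area_spec_ex w : evP w = 1%g -> exists n, spec w n.
Proof.
rewrite -(eval_word_nil (fp_gen P)) => /fp_ker.
(* The induction needs both ends of the equivalence to vary, so the area is taken of the quotient
   word; only the relator rule has a positive cost. *)
suff H u v : word_eqv (fun r => r \in fp_rels P) u v ->
    exists n, spec (u ++ wordV v) n.
  by move/H => [n]; rewrite cats0; exists n.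
elim=> {u v w} [w|u w _ [n /area_specV]|x u w _ [n un] _ [m wm]|u w x b|u w r rP].
- by exists 0%N; apply: area_spec_eqv area_spec0; exact: word_eqv_mulwV.
- by rewrite wordV_cat wordVK; exists n.
- exists (n + m)%N; apply: area_spec_eqv (area_specM un wm).
  rewrite -catA; apply: word_eqv_cat2l; rewrite catA -[X in word_eqv _ X _]cat0s.
  by apply: word_eqv_cat2r; apply: WordSym; exact: word_eqv_mulVw.
- exists 0%N; apply: area_spec_eqv area_spec0.
  apply: WordTrans (word_eqv_mulwV _ (u ++ w)); apply: word_eqv_cat2r.
  exact: WordCancel.
exists 1%N; rewrite wordV_cat.
apply: area_spec_eqv (area_spec_conj u (area_spec_rel rP)).
rewrite -!catA; do 2!apply: word_eqv_cat2l; rewrite catA -[X in word_eqv _ _ X]cat0s.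
by apply: word_eqv_cat2r; exact: word_eqv_mulwV.
Qed.

Lemma area_le w n : spec w n -> (area w <= n)%N.
Proof.
move=> wn; rewrite /area /least; case: pselect => [ex|[]] /=.
  by case: ex_minnP => m _; apply; apply/asboolP.
by exists n; apply/asboolP.
Qed.

(** [a_i] is replaced by the word [theta i], obtained by rewriting [a_i] in the basis and then
    back in the generators of [P]; a word trivial in [G] thus becomes freely trivial. *)
Lemma dehn_linear : exists C, forall n, (dehn P n <= C * n)%N.
Proof.
have [back backE] := choice (fun i => fp_surj P (fb_elt B i)).
pose theta i := word_subst back (fb_nf B (fp_gen P i)).
have thetaE i : evP (theta i) = fp_gen P i.
  rewrite eval_word_subst -[RHS](fb_nfK B); congr (eval_word _ _).
  by apply/funext => j; exact: backE.
have cost i : exists n, spec ((i, true) :: wordV (theta i)) n.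
  by apply: area_spec_ex; rewrite eval_word_cons eval_wordV thetaE mulgV.
have [c cE] := choice cost; pose C := (\max_i c i)%N; exists C.
have letter i b : exists2 n, (n <= C)%N &
    spec ((i, b) :: wordV (if b then theta i else wordV (theta i))) n.
  exists (c i); first exact: leq_bigmax.
  case: b => //; apply: area_spec_eqv (area_spec_conj (wordV (theta i)) (area_specV (cE i))).
  rewrite wordVK wordV_cons wordVK /=.
  apply: (@WordTrans _ _ ((wordV (theta i) ++ theta i) ++ [:: (i, false)] ++ theta i)).
    rewrite -[X in word_eqv _ X _]cat0s; apply: word_eqv_cat2r; apply: WordSym.
    exact: word_eqv_mulVw.
  by rewrite -!catA; exact: WordRefl.
(* The letters of [w] are exchanged for their images under [theta] one at a time, each at a cost of
   at most [C]; conjugation does not change the area. *)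
have main w : exists2 n, (n <= C * size w)%N & spec (w ++ wordV (word_subst theta w)) n.
  elim: w => [|[i b] w [n nC wn]]; first by exists 0%N; [rewrite muln0|exact: area_spec0].
  have [m mC im] := letter i b; exists (n + m)%N.
    by rewrite /= mulnS addnC leq_add.
  apply: area_spec_eqv (area_specM (area_spec_conj [:: (i, b)] wn) im).
  rewrite /word_subst /= wordV_cat -/(word_subst _ _) /=.
  set z := wordV (if b then _ else _); rewrite catA -[X in word_eqv _ X _]cat1s.
  rewrite -[(i, b) :: _ ++ _]cat1s -!catA; do 3!apply: word_eqv_cat2l.
  apply: WordSym; have := @WordCancel _ (fun=> False) [::] z i (~~ b); rewrite negbK; exact.
move=> n; apply/bigmax_leqP => m _; apply/bigmax_leqP => w /eqP w1.
have [q qC wq] := main w; rewrite size_tuple in qC.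
apply: (@leq_trans q); last by rewrite (leq_trans qC) // leq_mul2l -ltnS ltn_ord orbT.
apply: area_le; apply: area_spec_eqv wq; apply: WordSym.
rewrite -[X in word_eqv _ _ X]cats0; apply: word_eqv_cat2l.
suff /word_eqvV : feqv (word_subst theta w) [::] by [].
(* [theta] factors through words in the basis. There a word that evaluates to [1] is freely trivial,
   and [back] preserves free equivalence. *)
have -> : word_subst theta w = word_subst back (word_subst (fb_nf B \o fp_gen P) w).
  elim: {w1} (tval w) => //= l w' IHw'.
  rewrite /word_subst /= -/(word_subst _ _) map_cat flatten_cat -/(word_subst _ _).
  rewrite -/(word_subst back _) -IHw'; congr (_ ++ _); case: l.2 => //=.
  rewrite /theta; elim: (fb_nf _ _) => //= a s IHs.
  rewrite wordV_cons /word_subst /= map_cat flatten_cat wordV_cat -/(word_subst _ _) IHs.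
  by congr (_ ++ _); rewrite /= cats0; case: a.2; rewrite //= wordVK.
apply: (@word_subst_eqv _ _ _ _ _ [::]); apply/(fb_eqvP B).
rewrite eval_word_subst eval_word_nil -w1; congr (eval_word _ _).
by apply/funext => i; exact: fb_nfK.
Qed.

End FinitePresentation.

(** Linear upper bounds are enough, since the additive linear term of [dehn_dominated] absorbs
    them. *)
Lemma free_dehn_equivalent (G1 G2 : groupType) k1 k2
    (B1 : free_basis G1 k1) (B2 : free_basis G2 k2)
    (P1 : fin_presentation G1) (P2 : fin_presentation G2) :
  dehn_equivalent (dehn P1) (dehn P2).
Proof.
have [C1 lin1] := dehn_linear B1 P1; have [C2 lin2] := dehn_linear B2 P2.
split; [exists C1|exists C2] => n; rewrite -addnA addnCA.
  exact: leq_trans (lin1 n) (leq_addr _ _).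
exact: leq_trans (lin2 n) (leq_addr _ _).
Qed.

(** * Asymptotic dimension *)

Section WordMetrics.
Variables (R : realType) (G : groupType) (k : nat) (B : free_basis G k) (S : gen_family G).
Local Notation nf := (fb_nf B).
Local Notation T := (word_space R S).
Local Notation len := (word_length S).

Lemma mdistE (x y : T) : mdist x y = (len ((x : G)^-1 * (y : G))%g)%:R.
Proof. by []. Qed.

Lemma fb_size_bound : exists c, forall g, (size (nf g) <= c * len g)%N.
Proof.
exists (\max_i size (nf (gf_elt S i)))%N => g; set c := (\max_i _)%N.
have [w <- <-] := word_lengthP S g; elim: w => [|l w IHw].
  by rewrite eval_word_nil fb_nf1.
rewrite eval_word_cons /= mulnS; apply: leq_trans (fb_nfM_size _ _ _) (leq_add _ IHw).
have lc : (size (nf (gf_elt S l.1)) <= c)%N.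
  exact: (leq_bigmax l.1).
by case: l.2; rewrite ?fb_nfV ?size_wordV.
Qed.

Lemma word_length_bound : exists c, forall g, (len g <= c * size (nf g))%N.
Proof.
have [f fE] := choice (fun i => gf_gen S (fb_elt B i)).
pose c := (\max_i size (f i))%N; exists c => g.
rewrite -{1}[g](fb_nfK B); set w := nf g.
have -> : eval_word (fb_elt B) w = eval_word (gf_elt S) (word_subst f w).
  by rewrite eval_word_subst; congr (eval_word _ _); apply/funext => i; rewrite fE.
apply: leq_trans (word_length_le _ _) _.
elim: {g} w => //= l w IHw; rewrite /word_subst /= size_cat mulnS leq_add //.
have lc : (size (f l.1) <= c)%N by exact: (leq_bigmax l.1).
by case: l.2; rewrite ?size_wordV.
Qed.

Lemma mdist_ub : exists c, forall x y : T, mdist x y <= (c * fb_dist B x y)%:R.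
Proof.
by have [c cE] := word_length_bound; exists c => x y; rewrite mdistE ler_nat cE.
Qed.

Lemma mdist_lb : exists c, forall x y : T, (fb_dist B x y)%:R <= c%:R * mdist x y.
Proof.
by have [c cE] := fb_size_bound; exists c => x y; rewrite mdistE -natrM ler_nat cE.
Qed.

(** Sorting the elements by length into annuli of width [q], and each annulus by a prefix one annulus
    shorter, gives the two families (even and odd annuli) that bound the asymptotic dimension. *)
Definition shell q n (w : word 'I_k) : set T :=
  [set x | size (nf x) %/ q = n /\ take (n.-1 * q) (nf x) = w]%N.

(** Past the common prefix of length [(n - 1) q] each word has fewer than [2 q] letters left. For
    [n = 0] the prefix is empty and the words are shorter than [q]. *)
Lemma shell_diam q n w (x y : T) : (0 < q)%N ->
  shell q n w x -> shell q n w y -> (fb_dist B x y <= 4 * q)%N.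
Proof.
move=> q0 [xn xw] [yn yw].
have := fb_distE B x y.
have xl : (size (nf x) < n.+1 * q)%N by rewrite -xn -ltn_divLR.
have yl : (size (nf y) < n.+1 * q)%N by rewrite -yn -ltn_divLR.
have lp : (n.-1 * q <= lcp (nf x) (nf y))%N.
  rewrite leq_lcp xw yw eqxx andbT.
  have le z : (size (nf z) %/ q = n)%N -> (n.-1 * q <= size (nf z))%N.
    by move=> <-; rewrite (leq_trans _ (leq_trunc_div _ q)) // leq_mul2r leq_pred orbT.
  by rewrite !le.
case: n {xn xw yn yw} xl yl lp => [|n] /=; first by lia.
by rewrite !mulSn; lia.
Qed.

(** Lengths differ by less than [q], so the annuli are equal or adjacent, and parity excludes the
    latter. Twice the common prefix then exceeds [2 n q - q], which is more than [2 (n - 1) q]. *)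
Lemma near_shell q (x y : T) : (0 < q)%N -> (fb_dist B x y < q)%N ->
    odd (size (nf x) %/ q) = odd (size (nf y) %/ q) ->
  exists n w, shell q n w x /\ shell q n w y.
Proof.
move=> q0 xyq oddxy; have dE := fb_distE B x y.
have lx := lcp_leql (nf x) (nf y); have ly := lcp_leqr (nf x) (nf y).
have xyn : (size (nf x) %/ q = size (nf y) %/ q)%N.
  have step (a b : nat) : (a < b + q -> a %/ q <= (b %/ q).+1)%N.
    move=> ab; have -> : (b %/ q).+1 = ((b + q) %/ q)%N by rewrite divnDr // divnn q0 addn1.
    by rewrite leq_div2r // ltnW.
  have aux (a b l d : nat) : (d + l.*2 = a + b -> l <= a -> l <= b -> d < q -> a < b + q)%N.
    by lia.
  have s1 : (size (nf x) %/ q <= (size (nf y) %/ q).+1)%N.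
    by apply: step; exact: aux dE lx ly xyq.
  have s2 : (size (nf y) %/ q <= (size (nf x) %/ q).+1)%N.
    by apply: step; apply: aux ly lx xyq; rewrite dE addnC.
  move: (size (nf x) %/ q)%N (size (nf y) %/ q)%N oddxy s1 s2 => a b oddab s1 s2.
  have [//|[e|e]] : a = b \/ a = b.+1 \/ b = a.+1 by lia.
    by move: oddab; rewrite e /=; case: (odd b).
  by move: oddab; rewrite e /=; case: (odd a).
exists (size (nf x) %/ q)%N, (take ((size (nf x) %/ q).-1 * q) (nf x)).
split; split=> //; apply/esym.
set n := (size _ %/ q)%N.
have : ((n.-1 * q) <= lcp (nf x) (nf y))%N.
  have : (n * q <= size (nf x))%N by exact: leq_trunc_div.
  have : (n * q <= size (nf y))%N by rewrite /n xyn leq_trunc_div.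
  by case: n => //= n; rewrite mulSn; lia.
by rewrite leq_lcp => /and3P[_ _ /eqP].
Qed.

Lemma free_asdim_le1 : @asdim_le R T 1.
Proof.
move=> r r0; have [c ub] := mdist_ub; have [c' lb] := mdist_lb.
(* [q] exceeds [c' r], which bounds the tree distance of points at word distance at most [r]. *)
pose q := (Num.truncn (c'%:R * r)).+1.
exists (c * (4 * q))%:R, (fun p A => exists n w, odd n = (p == ord0 :> 'I_2) /\ A = shell q n w).
split.
- move=> x; pose n := (size (nf x) %/ q)%N.
  exists (if odd n then ord0 else ord_max), (shell q n (take (n.-1 * q) (nf x))) => //.
  by exists n, (take (n.-1 * q) (nf x)); case: (odd n).
- move=> p A [n [w [_ ->]]] x y xA yA; apply: le_trans (ub x y) _.
  by rewrite ler_nat leq_mul2l (shell_diam _ xA yA) ?orbT.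
move=> p A A' [n [w [np ->]]] [n' [w' [np' ->]]] AA' x y xA yA.
rewrite ltNge; apply/negP => xyr; apply: AA'.
have [xn xw] := xA; have [yn yw] := yA.
have xyq : (fb_dist B x y < q)%N.
  rewrite -(ltr_nat R); apply: le_lt_trans (lb x y) _.
  by apply: le_lt_trans (truncnS_gt _); rewrite ler_wpM2l.
have oddxy : odd (size (nf x) %/ q) = odd (size (nf y) %/ q) by rewrite xn yn np np'.
have [m [v [[xm xv] [ym yv]]]] := near_shell (ltn0Sn _) xyq oddxy.
by rewrite -xw -yw -xn -yn xm ym xv yv.
Qed.

(** At scale 1, neighbors in the Cayley graph cannot lie in different members of a single disjoint
    family, so one member is the whole group; the powers of a basis element show that it is
    unbounded. *)
Lemma free_asdim_gt0 : (0 < k)%N -> ~ @asdim_le R T 0.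
Proof.
move=> k0 /(_ 1 ltr01) [D [U [cover bounded disjoint]]].
have [i [A UA A1]] := cover (1%g : G).
have inA w : A (eval_word (gf_elt S) w).
  elim/last_ind: w => [|w l IHw]; first by rewrite eval_word_nil.
  set x := eval_word _ w in IHw; set y := eval_word _ (rcons w l).
  have [j [A' UA' A'y]] := cover y.
  have [->//|AA'] := pselect (A = A').
  rewrite (ord1 j) in UA'; rewrite (ord1 i) in UA.
  have := disjoint ord0 A A' UA UA' AA' x y IHw A'y.
  rewrite mdistE /y eval_word_rcons -/x mulKg ltNge => /negP[].
  by rewrite -(eval_word_seq1 (gf_elt S)) lern1; exact: word_length_le.
have [c lb] := mdist_lb.
pose n := (Num.truncn (c%:R * D)).+1; pose w : word 'I_k := nseq n (Ordinal k0, true).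
have rw : reduced w by rewrite /w; elim: (n) => //= -[|m].
have [v vE] := gf_gen S (eval_word (fb_elt B) w).
have := bounded i A UA _ _ A1 (inA v); rewrite vE => leD.
have := lb (1%g : G) (eval_word (fb_elt B) w).
rewrite /fb_dist invg1 mul1g fb_nf_eval // size_nseq leNgt => /negP; apply.
by apply: le_lt_trans (truncnS_gt _); rewrite ler_wpM2l.
Qed.

Lemma free_asdim : (0 < k)%N -> asdim T = Some 1%N.
Proof.
move=> k0; rewrite /asdim /least; case: pselect => [ex|[]].
  congr Some; case: ex_minnP => -[/asboolP /(free_asdim_gt0 k0)//|n] _ /(_ 1%N) min.
  apply/eqP; rewrite eqn_leq min //; apply/asboolP; exact: free_asdim_le1.
by exists 1%N; apply/asboolP; exact: free_asdim_le1.
Qed.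

End WordMetrics.

(** * Coarse embeddings *)

Section FreeEmbedding.
Variables (R : realType) (G H : groupType).

(** For the word metrics of the two bases, length is the size of the normal form, and carrying
    normal forms over is an isometry. *)
Lemma free_embeds k (B : free_basis G k) (C : free_basis H k) : coarsely_embeds R G H.
Proof.
have genB g : exists w, eval_word (fb_elt B) w = g by exists (fb_nf B g); exact: fb_nfK.
have genC g : exists w, eval_word (fb_elt C) w = g by exists (fb_nf C g); exact: fb_nfK.
have lenE (G' : groupType) (D : free_basis G' k)
    (gen : forall g, exists w, eval_word (fb_elt D) w = g) g :
    word_length (GenFamily gen) g = size (fb_nf D g).
  apply/eqP; rewrite eqn_leq; apply/andP; split.
    by rewrite -{1}[g](fb_nfK D); exact: (@word_length_le _ (GenFamily gen)).
  by have [w <- <-] := word_lengthP (GenFamily gen) g; exact: fb_nf_size.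
exists (GenFamily genB), (GenFamily genC), (fun g => eval_word (fb_elt C) (fb_nf B g)).
exists id, id; split => //.
move=> x y; rewrite !mdistE !lenE -eval_wordV -eval_word_cat fb_nf_red.
rewrite -[X in fb_nf B (X^-1 * _)%g](fb_nfK B) -[X in fb_nf B (_ * X)%g](fb_nfK B).
by rewrite -eval_wordV -eval_word_cat fb_nf_red lexx.
Qed.

(** With a single generator, a change of sign would be a cancellation. Hence a sign and a length
    determine the word, which is the linear growth of Z. *)
Lemma reduced_rank1 (w : word 'I_1) : reduced w ->
  w = nseq (size w) (ord0, (head (ord0, true) w).2).
Proof.
elim: w => //= -[i b] w IHw iw; rewrite (ord1 i) /=; congr cons.
rewrite [LHS]IHw; last exact: path_sorted iw.
case: w iw {IHw} => //= -[j c] w /andP[+ _].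
by rewrite /compat /flip /= (ord1 i) (ord1 j); case: b c => -[].
Qed.

Lemma exp_gt_affine K m : exists n, (2 * (K * (n + m)).+1 < 2 ^ n)%N.
Proof.
(* For [n = 2 p] the left side is [4 K p + 2 K m + 2], while [2 ^ n] is at least [(p + 1) ^ 2]; [p]
   collects the coefficients. *)
pose p := (4 * K + 2 * (K * m) + 2)%N; exists (p + p)%N; rewrite expnD.
have pp : (p.+1 * p.+1 <= 2 ^ p * 2 ^ p)%N by rewrite leq_mul // ltn_expl.
apply: leq_trans pp; rewrite /p; nia.
Qed.

(** The words [u x_0 ^ m] with [u] positive of length [n] are far apart, so that [f] separates
    them; but they are exponentially many, and [f] sends them to a ball of linear radius. *)
Lemma free_not_embeds (B : free_basis G 2) (C : free_basis H 1) : ~ coarsely_embeds R G H.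
Proof.
move=> [S [T [f [rm [rp [_ rmoo fE]]]]]].
have [cB lbB] := mdist_lb R B S; have [dB ubB] := mdist_ub R B S.
have [cC lbC] := mdist_lb R C T.
(* One generator moves a point by word distance 0 or 1, so [rp 0] and [rp 1] bound its effect on
   [f]; along words this makes [f] Lipschitz. *)
pose L := (Num.truncn (Num.max (rp 0) (rp 1))).+1.
have stepL x l : mdist (f x) (f (x * eval_word (gf_elt S) [:: l])%g) <= L%:R.
  have /andP[_ le] := fE x (x * eval_word (gf_elt S) [:: l])%g.
  apply: le_trans le _; rewrite mdistE mulKg.
  have le1 : (word_length S (eval_word (gf_elt S) [:: l]) <= 1)%N by exact: word_length_le.
  apply: le_trans (ltW (truncnS_gt _)).
  by case: word_length le1 => [|[|//]] _; rewrite le_max lexx ?orbT.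
have lipw x w : mdist (f x) (f (x * eval_word (gf_elt S) w)%g) <= L%:R * (size w)%:R.
  elim/last_ind: w => [|w l IHw]; first by rewrite eval_word_nil mulg1 mdistxx mulr0.
  rewrite -cats1 eval_word_cat mulgA size_cat addn1 -natr1 mulrDr mulr1.
  exact: le_trans (metric_triangle _ _ _) (lerD IHw (stepL _ _)).
have lip x y : mdist (f x) (f y) <= L%:R * mdist x y.
  rewrite [mdist x y]mdistE; have [w <- wE] := word_lengthP S ((x : G)^-1 * (y : G))%g.
  by have := lipw x w; rewrite wE mulVKg.
have [M [_ MP]] : \forall t \near +oo, 0 < rm t.
  by move/cvgryPgt : rmoo; exact.
(* Chosen so that tree distance at least [m] forces word distance beyond [M], where [rm] is
   positive. *)
pose m := (Num.truncn (cB%:R * (Num.max M 0 + 1))).+1.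
have sep (x y : word_space R S) : (m <= fb_dist B x y)%N -> f x <> f y.
  move=> mxy fxy; suff : M < mdist x y.
    by move/MP; have /andP[+ _] := fE x y; rewrite fxy mdistxx leNgt => /negP.
  rewrite ltNge; apply/negP => xyM; move: mxy; rewrite leqNgt => /negP; apply.
  rewrite -(ltr_nat R); apply: le_lt_trans (lbB x y) _.
  apply: le_lt_trans (truncnS_gt _); rewrite ler_wpM2l //.
  apply: le_trans xyM _; rewrite -[leLHS]addr0 lerD // le_max lexx ?orbT //.
have [n nbig] := exp_gt_affine (cC * L * dB) m.
pose letter (b : bool) : 'I_2 * bool := (if b then ord_max else ord0, true).
have letterI : injective letter by case=> -[].
pose wd (b : n.-tuple bool) : word 'I_2 := map letter b ++ nseq m (letter false).
have swd b : size (wd b) = (n + m)%N by rewrite size_cat size_map size_tuple size_nseq.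
have rwd b : reduced (wd b).
  have : all (fun l => l.2) (wd b) by rewrite all_cat all_map all_nseq orbT andbT; apply/allP.
  elim: (wd b) => //= a [|c w] //= IHw /and3P[a2 c2 w2]; rewrite IHw ?c2 // andbT.
  by apply: contraTneq c2 => ->; rewrite /flip /= a2.
pose g b := eval_word (fb_elt B) (wd b).
have gI b b' : f (g b) = f (g b') -> b = b'.
  move=> e; apply/eqP; apply: contraPT e => bb'; apply: sep.
  have := fb_distE B (g b) (g b'); rewrite !fb_nf_eval // !swd.
  (* Words that branch before position [n] have both tails of length [m] beyond the branching, so
     their distance exceeds [2 m]. *)
  suff : (lcp (wd b) (wd b') < n)%N by lia.
  rewrite ltnNge leq_lcp !swd leq_addr /=; apply: contra bb'.
  by rewrite !take_size_cat ?size_map ?size_tuple // => /eqP /(inj_map letterI) /val_inj ->.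
pose K := (cC * L * dB * (n + m))%N.
pose h b := fb_nf C ((f (1%g : G))^-1 * f (g b))%g.
have hK b : (size (h b) < K.+1)%N.
  rewrite ltnS -(ler_nat R) /K -!mulnA natrM; apply: le_trans (lbC (f (1%g : G)) (f (g b))) _.
  rewrite ler_wpM2l // natrM; apply: le_trans (lip _ _) _.
  rewrite ler_wpM2l //; apply: le_trans (ubB _ _) _.
  by rewrite ler_nat leq_mul2l /fb_dist invg1 mul1g fb_nf_eval // swd leqnn orbT.
(* Only [2 (K + 1)] codes exist, for [2 ^ n] words, and [nbig] makes this too few. *)
pose code b : bool * 'I_K.+1 := ((head (ord0, true) (h b)).2, Ordinal (hK b)).
have codeI : injective code.
  have rh b : h b = nseq (size (h b)) (ord0, (head (ord0, true) (h b)).2).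
    exact: reduced_rank1 (fb_reduced C _).
  move=> b b' [e1 e2]; apply: gI; have : h b = h b' by rewrite (rh b) (rh b') e1 e2.
  by move/fb_nf_inj/mulgI.
have := leq_card code codeI; rewrite card_prod card_tuple card_bool card_ord.
by rewrite leqNgt nbig.
Qed.

End FreeEmbedding.

(** * The Fox resolution *)

Section FreeAbelian.
Variables (K : choiceType).
Local Notation FA := {freeg K / int}.

Definition fa_gen (x : K) : FA := << (1 : int) *g x >>.

Definition fa_lift (M : zmodType) (f : K -> M) (D : FA) : M :=
  fglift (f : K -> zmodule M) D.

Lemma fa_lift_is_additive (M : zmodType) (f : K -> M) : additive (fa_lift f).
Proof. exact: (@lift_is_additive _ _ (zmodule M)). Qed.

HB.instance Definition _ (M : zmodType) (f : K -> M) :=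
  GRing.isAdditive.Build FA M (fa_lift f) (fa_lift_is_additive f).

Lemma fa_lift_gen (M : zmodType) (f : K -> M) x : fa_lift f (fa_gen x) = f x.
Proof. by rewrite /fa_lift /fa_gen liftU scale1r. Qed.

Lemma fa_sum (D : FA) : D = \sum_(t <- repr D) fa_gen t.2 *~ t.1.
Proof.
rewrite -{1}[D]freeg_repr; case: (repr D) => s _ /=; elim: s => [|t s IHs].
  by rewrite big_nil freeg_nil.
rewrite big_cons -cat1s freeg_cat IHs; congr (_ + _).
by rewrite freegU_mulz intz -surjective_pairing.
Qed.

Lemma fa_ind (P : FA -> Prop) : P 0 ->
    (forall x D, P D -> P (D + fa_gen x)) -> (forall x D, P D -> P (D - fa_gen x)) ->
  forall D, P D.
Proof.
move=> P0 PD PB D; rewrite -[D]add0r (fa_sum D).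
suff H E : P E -> P (E + \sum_(t <- repr D) fa_gen t.2 *~ t.1) by exact: H.
case: (repr D) => s _ /=; elim: s E => [|[n x] s IHs] E PE; first by rewrite big_nil addr0.
rewrite big_cons addrA; apply: IHs => /=; elim/int_ind: n E PE => [|n IHn|n IHn] E PE.
- by rewrite mulr0z addr0.
- by rewrite intS mulrzDr mulr1z addrA; apply: IHn; exact: PD.
- by rewrite intS opprD mulrzDr mulrNz mulr1z addrA; apply: IHn; exact: PB.
Qed.

Lemma fa_eq (M : zmodType) (f g : FA -> M) :
    (forall D E, f (D + E) = f D + f E) -> (forall D E, g (D + E) = g D + g E) ->
  (forall x, f (fa_gen x) = g (fa_gen x)) -> f =1 g.
Proof.
move=> fD gD fg; elim/fa_ind => [|x D IHD|x D IHD].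
- have add0 (h : FA -> M) : (forall D E, h (D + E) = h D + h E) -> h 0 = 0.
    by move=> hD; apply: (addrI (h 0)); rewrite -hD !addr0.
  by rewrite !add0.
- by rewrite fD gD IHD fg.
by apply: (addIr (f (fa_gen x))); rewrite -fD fg -gD !subrK.
Qed.

End FreeAbelian.

Section FreeModules.
Variables (G : groupType) (n : nat).
Local Notation K := (G * 'I_n)%type.
Local Notation FA := {freeg K / int}.

Definition fa_act (g : G) : FA -> FA := fa_lift (fun t : K => fa_gen ((g * t.1)%g, t.2)).

Lemma fa_act_gen g t : fa_act g (fa_gen t) = fa_gen ((g * t.1)%g, t.2).
Proof. exact: fa_lift_gen. Qed.

Fact fa_act1 D : fa_act 1%g D = D.
Proof.
move: D; apply: fa_eq => // [D E|x]; first exact: raddfD.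
by rewrite fa_act_gen mul1g -surjective_pairing.
Qed.

Fact fa_actM g h D : fa_act (g * h)%g D = fa_act g (fa_act h D).
Proof.
move: D; apply: fa_eq => [D E|D E|x]; rewrite ?fa_act_gen ?mulgA //.
  exact: raddfD.
by rewrite /fa_act !raddfD.
Qed.

Fact fa_actD g D E : fa_act g (D + E) = fa_act g D + fa_act g E.
Proof. exact: raddfD. Qed.

Definition free_gmodule : gmodule G := GModule fa_act1 fa_actM fa_actD.

Lemma fa_lift_hom (M : gmodule G) (f : K -> M) :
    (forall g t, f ((g * t.1)%g, t.2) = gm_act g (f t)) ->
  gm_hom (fa_lift f : free_gmodule -> M).
Proof.
move=> fG; split=> [D E|g]; first exact: raddfD.
apply: fa_eq => [D E|D E|x] /=.
- by rewrite fa_actD raddfD.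
- by rewrite raddfD gm_actD.
by rewrite fa_act_gen !fa_lift_gen fG.
Qed.

Lemma free_projective : gm_projective free_gmodule.
Proof.
move=> M N p f [pD pG] surj [fD fG].
have [m mE] := choice (fun j => surj (f (fa_gen (1%g, j)))).
have homh := @fa_lift_hom M (fun t => gm_act t.1 (m t.2)) (fun g t => gm_actM _ _ _).
exists (fa_lift (fun t => gm_act t.1 (m t.2))) => // x; move: x.
apply: fa_eq => // [D E|[a j]]; first by rewrite raddfD pD.
by rewrite fa_lift_gen pG mE -fG /= fa_act_gen mulg1.
Qed.

Lemma free_fin_gen : gm_fin_gen free_gmodule.
Proof.
exists n, (fun j => fa_gen (1%g, j)) => D.
exists [seq (t.1, t.2.1, t.2.2) | t <- repr (D : FA)].
rewrite big_map {1}(fa_sum D); apply: eq_bigr => t _ /=.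
by rewrite fa_act_gen mulg1 -surjective_pairing.
Qed.

End FreeModules.

Lemma free_gmodule0 (G : groupType) (D : free_gmodule G 0) : D = 0.
Proof. by move: D; apply: fa_ind => // -[g []]. Qed.

Section FoxResolution.
Variables (G : groupType) (k : nat) (B : free_basis G k).
Local Notation x := (fb_elt B).
Local Notation ev := (eval_word x).
Local Notation P0 := (free_gmodule G 1).
Local Notation P1 := (free_gmodule G k).

Definition vtx (g : G) : P0 := fa_gen (g, ord0).

Definition boundary : P1 -> P0 := fa_lift (fun t => vtx (t.1 * x t.2)%g - vtx t.1).

Definition augment : P0 -> trivial_gmodule G := fa_lift (fun=> 1 : int).

Lemma boundary_hom : gm_hom boundary.
Proof.
apply: fa_lift_hom => g t /=; rewrite [RHS]raddfB /=.
by rewrite -!/(fa_act _ _) !fa_act_gen mulgA.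
Qed.

Lemma augment_hom : gm_hom augment.
Proof. exact: fa_lift_hom. Qed.

(** The Fox derivative: the edge path from [1] to [ev w] in the Cayley tree. *)
Fixpoint fox (w : word 'I_k) : P1 :=
  if w is l :: w' then
    (if l.2 then fa_gen (1%g, l.1) else - fa_gen ((x l.1)^-1%g, l.1))
      + gm_act (ev [:: l]) (fox w')
  else 0.

Lemma fox_cat u w : fox (u ++ w) = fox u + gm_act (ev u) (fox w).
Proof.
elim: u => [|l u IHu] /=; first by rewrite add0r eval_word_nil fa_act1.
by rewrite IHu fa_actD addrA -fa_actM -eval_word_cat.
Qed.

(** A letter followed by its inverse runs through one edge in both directions, and the two
    contributions cancel. *)
Lemma fox_eqv u w : word_eqv (fun=> False) u w -> fox u = fox w.
Proof.
elim=> {u w} [//|u w _ -> //|y u w _ -> _ -> //|u w i b|//].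
rewrite !fox_cat; congr (_ + gm_act _ _); rewrite /= fa_actD -fa_actM addrA.
rewrite -eval_word_cat; have -> : ev ([:: (i, b)] ++ [:: (i, ~~ b)]) = 1%g.
  by rewrite eval_word_cons eval_word_seq1; case: b; rewrite /= ?mulgV ?mulVg.
rewrite fa_act1 eval_word_seq1 -[RHS]add0r; congr (_ + _); case: b => /=.
  by rewrite /fa_act raddfN /= -/(fa_act _ _) fa_act_gen mulgV subrr.
by rewrite fa_act_gen mulg1 addNr.
Qed.

(** The fundamental formula of Fox calculus: the boundary of an edge path telescopes to its end
    minus its origin. *)
Lemma boundary_fox w : boundary (fox w) = vtx (ev w) - vtx 1%g.
Proof.
elim: w => [|l w IHw]; first by rewrite /= /boundary raddf0 eval_word_nil subrr.
have [dD dG] := boundary_hom.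
rewrite [fox _]/= dD dG IHw /= /fa_act raddfB /= -!/(fa_act _ _) !fa_act_gen mulg1.
rewrite -eval_word_cat eval_word_seq1 /= /boundary.
case: l.2; rewrite ?raddfN /= fa_lift_gen /= ?mul1g ?mulVg; set a := vtx _.
  by rewrite addrC addrA subrK.
by rewrite opprB addrC addrA subrK.
Qed.

(** A contracting homotopy: a vertex goes to the geodesic that joins it to [1]. It is additive but
    not equivariant, which is all that exactness asks for. *)
Definition contraction : P0 -> P1 := fa_lift (fun t => fox (fb_nf B t.1)).

(** The geodesic to [a * x i] is freely equivalent to the geodesic to [a] followed by the edge, so
    the two Fox chains differ by that edge. This gives injectivity of [boundary]: a tree has no
    cycles. *)
Lemma contraction_boundary D : contraction (boundary D) = D.
Proof.
move: D; apply: fa_eq => // [D E|[a i]]; first by rewrite /contraction /boundary !raddfD.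
rewrite /boundary fa_lift_gen /contraction raddfB /= !fa_lift_gen /=.
have -> : fox (fb_nf B (a * x i)%g) = fox (fb_nf B a ++ [:: (i, true)]).
  apply/fox_eqv/(fb_eqvP B).
  by rewrite eval_word_cat eval_word_seq1 !fb_nfK.
by rewrite fox_cat addrC addKr /= fa_actD fb_nfK fa_act_gen mulg1 /fa_act !raddf0 addr0.
Qed.

Lemma boundary_contraction D : boundary (contraction D) = D - vtx 1%g *~ augment D.
Proof.
move: D; apply: fa_eq => [D E|D E|[a i]].
- by rewrite /contraction /boundary !raddfD.
- by rewrite /augment raddfD mulrzDr opprD addrACA.
rewrite /contraction /augment !fa_lift_gen boundary_fox fb_nfK mulr1z /=.
by rewrite (ord1 i).
Qed.

Lemma augment_boundary D : augment (boundary D) = 0.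
Proof.
move: D; apply: fa_eq => [D E|D E|t]; rewrite ?addr0 //.
  by rewrite /augment /boundary !raddfD.
by rewrite /boundary fa_lift_gen /augment raddfB /= !fa_lift_gen subrr.
Qed.

Lemma free_type_FP n : type_FP G n.
Proof.
(* These are the cellular chains of the Cayley tree: one orbit of vertices, [k] orbits of edges,
   nothing above. *)
pose rank i := if i is i'.+1 then if i' is 0 then k else 0%N else 1%N.
pose P i := free_gmodule G (rank i).
pose d i : P i.+1 -> P i := if i is 0 then boundary else fun=> 0.
exists P, d, augment; split.
- split; last 1 first.
  + by move=> z; exists (vtx 1%g *~ z); rewrite /augment raddfMz /= fa_lift_gen intz.
  + move=> [|i]; first exact: boundary_hom.
    by split=> [D E|g D]; rewrite /d ?addr0 //= /fa_act raddf0.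
  exact: augment_hom.
- move=> D; split=> [D0|[E <-]]; last exact: augment_boundary.
  by exists (contraction D); rewrite /d boundary_contraction D0 mulr0z subr0.
- move=> [|i] D; last first.
    by split=> _; [exists 0; rewrite [RHS](free_gmodule0 D)|].
  split=> [D0|[E <-]]; last by rewrite /d /boundary raddf0.
  by exists 0; rewrite -[RHS]contraction_boundary [boundary D]D0 /contraction raddf0.
- by move=> i; exact: free_projective.
by move=> i _; exact: free_fin_gen.
Qed.

End FoxResolution.

(** * The rose *)

Section Rose.
Variables (R : realType) (k : nat).

(** [None] is the base point. *)
Definition rose : Type := option ('I_k * {t : R | 0 < t < 1}).

HB.instance Definition _ := Choice.on rose.

(** The base point when [t] is not in ]0, 1[, which makes [petal i] 1-Lipschitz on all of [R]. *)
Definition petal (i : 'I_k) (t : R) : rose := omap (pair i) (insub t).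

Definition rheight (z : rose) : R :=
  if z is Some (_, t) then Num.min (val t) (1 - val t) else 0.

(** The path metric on a wedge of circles of length 1: inside a petal the direct arc competes with
    the route through the base point. *)
Definition rdist (z z' : rose) : R :=
  match z, z' with
  | Some (i, t), Some (j, u) =>
    if i == j then Num.min `|val t - val u| (rheight z + rheight z')
    else rheight z + rheight z'
  | _, _ => rheight z + rheight z'
  end.

Variant rose_spec : rose -> Type :=
| RoseBase : rose_spec None
| RosePetal i t (t01 : 0 < t < 1) : rose_spec (petal i t).

Lemma roseP z : rose_spec z.
Proof.
case: z => [[i u]|]; last exact: RoseBase.
have -> : Some (i, u) = petal i (val u) by rewrite /petal valK.
exact: RosePetal (valP u).
Qed.

Lemma petalE i t (t01 : 0 < t < 1) : petal i t = Some (i, exist _ t t01).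
Proof. by rewrite /petal insubT. Qed.

Lemma petal_out i t : ~~ (0 < t < 1) -> petal i t = None.
Proof. by move=> t01; rewrite /petal insubN. Qed.

Lemma petal0 i : petal i 0 = None.
Proof. by rewrite petal_out // ltxx. Qed.

Lemma petal1 i : petal i 1 = None.
Proof. by rewrite petal_out // ltxx andbF. Qed.

Lemma rheight_petal i t : 0 < t < 1 -> rheight (petal i t) = Num.min t (1 - t).
Proof. by move=> t01; rewrite petalE. Qed.

Lemma rheight_ge0 z : 0 <= rheight z.
Proof.
case: (roseP z) => // i t t01; rewrite rheight_petal //.
by rewrite le_min; move/andP: t01 => [? ?]; apply/andP; split; lra.
Qed.

Lemma rdistC z z' : rdist z z' = rdist z' z.
Proof.
case: z z' => [[i t]|] [[j u]|]; rewrite /rdist; last first; try exact: addrC.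
by rewrite eq_sym distrC (addrC (rheight _)).
Qed.

Lemma rdist_base z : rdist z None = rheight z.
Proof. by case: z => [[i t]|]; rewrite /rdist addr0. Qed.

Lemma rdist_le z z' : rdist z z' <= rheight z + rheight z'.
Proof.
case: z z' => [[i t]|] [[j u]|] //; rewrite /rdist; case: ifP => // _.
by rewrite ge_min lexx orbT.
Qed.

Lemma rdist_petal i t u : rdist (petal i t) (petal i u) <= `|t - u|.
Proof.
have half (s v : R) : 0 < s < 1 -> ~~ (0 < v < 1) -> Num.min s (1 - s) <= `|s - v|.
  move=> /andP[s0 s1]; rewrite ge_min; case: (lerP v 0) => [v0 _|v0 /=].
    by rewrite ger0_norm; [apply/orP; left; lra|lra].
  by rewrite -leNgt => v1; rewrite ler0_norm; [apply/orP; right; lra|lra].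
have [t01|t01] := boolP (0 < t < 1); have [u01|u01] := boolP (0 < u < 1).
- by rewrite !petalE /rdist eqxx ge_min lexx.
- by rewrite (petal_out i u01) petalE /= addr0 half.
- by rewrite (petal_out i t01) petalE /= add0r distrC half.
- by rewrite !petal_out //= addr0.
Qed.

Lemma rheight_lip z z' : rheight z' <= rheight z + rdist z z'.
Proof.
case: (roseP z) => [|i t t01]; first by rewrite /= !add0r.
case: (roseP z') => [|j u u01]; first by rewrite addr_ge0 ?rheight_ge0 //
  rdistC /= add0r rheight_ge0.
have h := rheight_ge0 (petal i t).
have e : rdist (petal i t) (petal j u) =
    if i == j then Num.min `|t - u| (rheight (petal i t) + rheight (petal j u))
    else rheight (petal i t) + rheight (petal j u) by rewrite !petalE.
rewrite e; case: ifP => _; last by lra.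
rewrite /Num.min; case: ifP => _; last by lra.
rewrite !rheight_petal //; case: (ger0P (t - u)) => ?; rewrite /Num.min;
  by case: ifP; case: ifP; lra.
Qed.

Lemma rdist_cases z z' : rdist z z' = rheight z + rheight z' \/
  exists i t u, [/\ z = petal i t, z' = petal i u, 0 < t < 1, 0 < u < 1 &
    rdist z z' = `|t - u|].
Proof.
case: (roseP z) => [|i t t01]; first by left.
case: (roseP z') => [|j u u01]; first by left; rewrite petalE.
have [->|ij] := eqVneq i j; last by left; rewrite !petalE /rdist (negbTE ij).
rewrite !petalE /rdist eqxx /Num.min; case: ifP => _; last by left.
by right; exists j, t, u; rewrite !petalE t01 u01.
Qed.

Lemma rdist_triangle z' z z'' : rdist z z'' <= rdist z z' + rdist z' z''.
Proof.
have le := rdist_le z z''.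
have h := rheight_lip z' z; rewrite rdistC in h.
have h'' := rheight_lip z' z''.
have [e|[i [t [u [zE z'E _ _ e]]]]] := rdist_cases z z'; first by lra.
have [e'|[j [t' [v [z'E' z''E _ _ e']]]]] := rdist_cases z' z''; first by lra.
(* The middle point lies on both petals, so it is the base point unless the petals and the
   parameters agree. *)
have [z'0|[ij ut']] : z' = None \/ i = j /\ u = t'.
  move: z'E'; rewrite z'E; have [u01|/petal_out->] := boolP (0 < u < 1); last by left.
  have [t'01|/petal_out->] := boolP (0 < t' < 1); last by left.
  by rewrite !petalE => -[ij ut]; right.
  have -> : rdist z z' = rheight z by rewrite z'0 rdist_base.
  have -> : rdist z' z'' = rheight z'' by rewrite z'0 rdistC rdist_base.
  exact: le.
rewrite e e' zE z''E -ij -ut'; apply: le_trans (rdist_petal _ _ _) _.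
by rewrite (le_trans _ (ler_normD _ _)) // addrA subrK.
Qed.

Lemma rdistxx z : rdist z z = 0.
Proof.
case: (roseP z) => [|i t t01]; first by rewrite /= addr0.
apply/eqP; rewrite eq_le; apply/andP; split.
  by apply: le_trans (rdist_petal _ _ _) _; rewrite subrr normr0.
by have := rheight_lip (petal i t) (petal i t); lra.
Qed.

Lemma rheight_eq0 z : rheight z = 0 -> z = None.
Proof.
case: (roseP z) => // i t t01; rewrite rheight_petal // /Num.min.
by move/andP: t01 => [? ?] e; exfalso; move: e; case: ifP; lra.
Qed.

Lemma rdist_positivity z z' : rdist z z' = 0 -> z = z'.
Proof.
have h := rheight_ge0 z; have h' := rheight_ge0 z'.
have [->|[i [t [u [-> -> _ _ ->]]]]] := rdist_cases z z'.
  move=> e; have -> : z = None by apply: rheight_eq0; lra.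
  by apply/esym/rheight_eq0; lra.
by move=> /eqP; rewrite normr_eq0 subr_eq0 => /eqP ->.
Qed.

HB.instance Definition _ := isMetric.Build R rose
  rdistxx rdist_positivity rdistC rdist_triangle.

Lemma mdist_rose (z z' : rose) : mdist z z' = rdist z z'.
Proof. by []. Qed.

End Rose.
Arguments petal {R k} i t.
Arguments rdist {R k} z z'.

(** * The Cayley tree *)

Lemma lcp_take (S : choiceType) m n (u v : word S) :
  lcp (take m u) (take n v) = minn (minn m n) (lcp u v).
Proof.
elim: m n u v => [|m IHm] [|n] [|a u] [|b v] //=; rewrite ?min0n ?minn0 //.
by case: (a == b); rewrite ?minn0 // IHm !minnSS.
Qed.

Lemma natr_minn (R : realType) m n : (minn m n)%:R = Num.min m%:R n%:R :> R.
Proof. by rewrite /minn minElt ltr_nat; case: ifP. Qed.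

Section Tree.
Variables (R : realType) (G : groupType) (k : nat) (B : free_basis G k).
Local Notation x_ := (fb_elt B).
Local Notation ev := (eval_word x_).
Local Notation nf := (fb_nf B).
Local Notation rose := (rose R k).
Local Notation T := (G * rose)%type.
Implicit Types (x y z : T) (g : G) (u v w : word 'I_k) (a b t s : R).

(** [(g, petal i t)] is the point at distance [t] from [g] on the edge from [g] to [g * x_ i]
    of the Cayley tree, [tree_word] is the shortest path from [1] that covers it, and
    [tree_len] its distance to [1]. *)
Definition tree_word x : word 'I_k :=
  match x.2 with
  | None => nf x.1
  | Some (i, _) =>
    if (size (nf x.1) < size (nf (x.1 * x_ i)%g))%N then nf (x.1 * x_ i)%g else nf x.1
  end.

Definition tree_len x : R :=
  match x.2 with
  | None => (size (nf x.1))%:R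
  | Some (i, t) => (size (nf x.1))%:R +
      val t * ((size (nf (x.1 * x_ i)%g))%:R - (size (nf x.1))%:R)
  end.

(** The point at distance [t] past the vertex [ev u] along [l]. For an inverse letter the edge
    starts at the far end, whence the parameter [1 - t]. *)
Definition tree_step u (l : 'I_k * bool) t : T :=
  if l.2 then (ev u, petal l.1 t) else (ev (rcons u l), petal l.1 (1 - t)).

(** The point at distance [a] along the path [w] from [1]; the last branch is a default outside
    [0 <= a <= size w]. *)
Definition tree_at w a : T :=
  let n := Num.truncn a in
  if a == n%:R then (ev (take n w), None)
  else if drop n w is l :: _ then tree_step (take n w) l (a - n%:R) else (1%g, None).

Lemma nf_mulx g i : nf (g * x_ i)%g = rcons (nf g) (i, true) \/
  exists2 u, nf g = rcons u (i, false) & (g * x_ i)%g = ev u.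
Proof.
have gx : (g * x_ i)%g = ev (rcons (nf g) (i, true)) by rewrite eval_word_rcons fb_nfK.
have := fb_reduced B g; case/lastP E : (nf g) => [|u m] red_g.
  by left; rewrite gx E fb_nf_eval.
have [mi|mi] := eqVneq m (i, false).
  right; exists u; first by rewrite mi.
  by rewrite -[g](fb_nfK B) E mi eval_word_rcons mulgVK.
left; rewrite gx E fb_nf_eval // reduced_rcons red_g; apply/orP; right.
rewrite last_rcons /compat; apply: contra mi => /eqP e.
by rewrite -[m]flipK -e.
Qed.

Lemma tree_word_step u l t : reduced (rcons u l) -> 0 < t < 1 ->
  tree_word (tree_step u l t) = rcons u l.
Proof.
move=> rul t01; have ru : reduced u by move: rul; rewrite reduced_rcons => /andP[].
case: l rul => i [] rul; rewrite /tree_word /tree_step /=.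
  rewrite petalE fb_nf_eval //.
  have -> : (ev u * x_ i)%g = ev (rcons u (i, true)) by rewrite eval_word_rcons.
  by rewrite fb_nf_eval // size_rcons leqnn.
have t01' : 0 < 1 - t < 1 by lra.
rewrite petalE fb_nf_eval //.
have -> : (ev (rcons u (i, false)) * x_ i)%g = ev u by rewrite eval_word_rcons mulgVK.
by rewrite fb_nf_eval // size_rcons ltnNge leqnSn.
Qed.

Lemma tree_len_step u l t : reduced (rcons u l) -> 0 < t < 1 ->
  tree_len (tree_step u l t) = (size u)%:R + t.
Proof.
move=> rul t01; have ru : reduced u by move: rul; rewrite reduced_rcons => /andP[].
case: l rul => i [] rul; rewrite /tree_len /tree_step /=.
  rewrite petalE /= fb_nf_eval //.
  have -> : (ev u * x_ i)%g = ev (rcons u (i, true)) by rewrite eval_word_rcons.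
  by rewrite fb_nf_eval // size_rcons -natr1; lra.
have t01' : 0 < 1 - t < 1 by lra.
rewrite petalE /= fb_nf_eval //.
have -> : (ev (rcons u (i, false)) * x_ i)%g = ev u by rewrite eval_word_rcons mulgVK.
by rewrite fb_nf_eval // size_rcons -natr1; lra.
Qed.

(** Polar coordinates around [1]: edges are read away from [1], whatever the orientation that their
    generator gives them. *)
Variant tree_spec : T -> word 'I_k -> R -> Type :=
| TreeVertex w of reduced w : tree_spec (ev w, None) w (size w)%:R
| TreeEdge u l t of reduced (rcons u l) & 0 < t < 1 :
    tree_spec (tree_step u l t) (rcons u l) ((size u)%:R + t).

Lemma treeP x : tree_spec x (tree_word x) (tree_len x).
Proof.
case: x => g z; case: (roseP z) => [|i t t01].
  rewrite /tree_word /tree_len /= -{1}[g](fb_nfK B); apply: TreeVertex.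
  exact: fb_reduced.
have [e|] := pselect (nf (g * x_ i)%g = rcons (nf g) (i, true)).
  have -> : (g, petal i t) = tree_step (nf g) (i, true) t by rewrite /tree_step fb_nfK.
  have r : reduced (rcons (nf g) (i, true)) by rewrite -e fb_reduced.
  by rewrite tree_word_step ?tree_len_step //; exact: TreeEdge.
move=> ne; have /cid2 [u e _] : exists2 u, nf g = rcons u (i, false) & (g * x_ i)%g = ev u.
  by have [] := nf_mulx g i.
have -> : (g, petal i t) = tree_step u (i, false) (1 - t).
  by rewrite /tree_step /= -e fb_nfK subKr.
have r : reduced (rcons u (i, false)) by rewrite -e fb_reduced.
have t01' : 0 < 1 - t < 1 by lra.
by rewrite tree_word_step ?tree_len_step //; exact: TreeEdge.
Qed.

Lemma tree_word_reduced x : reduced (tree_word x).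
Proof. by case: treeP. Qed.

Lemma tree_len_ge0 x : 0 <= tree_len x.
Proof. by case: treeP => // u l t _ /andP[t0 _]; rewrite addr_ge0 // ltW. Qed.

Lemma tree_len_le x : tree_len x <= (size (tree_word x))%:R.
Proof. by case: treeP => // u l t _ t01; rewrite size_rcons -natr1; lra. Qed.

Lemma tree_len_gt x : (size (tree_word x))%:R - 1 < tree_len x.
Proof.
by case: treeP => [w _|u l t _ t01]; [lra|rewrite size_rcons -natr1; lra].
Qed.

Lemma tree_at_nat w n : tree_at w n%:R = (ev (take n w), None).
Proof. by rewrite /tree_at natrK eqxx. Qed.

Lemma tree_at_step u l v t : 0 < t < 1 ->
  tree_at (u ++ l :: v) ((size u)%:R + t) = tree_step u l t.
Proof.
move=> /andP[t0 t1]; rewrite /tree_at.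
have -> : Num.truncn ((size u)%:R + t) = size u.
  by apply: truncn_def; rewrite lerDl ltW //= -natr1 ltrD2l.
rewrite -subr_eq0 addrAC subrr add0r gt_eqF //.
by rewrite drop_size_cat // take_size_cat // addrAC subrr add0r.
Qed.

Variant tree_at_spec w : R -> T -> Type :=
| TreeAtVertex n of (n <= size w)%N : tree_at_spec w n%:R (ev (take n w), None)
| TreeAtEdge u l v t of w = u ++ l :: v & 0 < t < 1 :
    tree_at_spec w ((size u)%:R + t) (tree_step u l t).

Lemma tree_atP w a : 0 <= a <= (size w)%:R -> tree_at_spec w a (tree_at w a).
Proof.
move=> /andP[a0 aw]; pose n := Num.truncn a.
have /andP[na an] := truncn_itv a0; rewrite -/n in na an.
have [e|ne] := eqVneq a n%:R.
  rewrite e tree_at_nat; apply: TreeAtVertex.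
  by rewrite -(ler_nat R) -e.
have nw : (n < size w)%N by rewrite -(ltr_nat R) (lt_le_trans _ aw) // lt_neqAle eq_sym ne.
case E : (drop n w) => [|l v].
  by move: (congr1 size E); rewrite size_drop /= => /eqP; rewrite subn_eq0 leqNgt nw.
have wE : w = take n w ++ l :: v by rewrite -E cat_take_drop.
have sn : size (take n w) = n by rewrite size_take nw.
have t01 : 0 < a - n%:R < 1.
  by rewrite subr_gt0 lt_neqAle eq_sym ne na /= ltrBlDl natr1.
have := TreeAtEdge wE t01; rewrite sn subrKC.
by have := tree_at_step (take n w) l v t01; rewrite -wE sn subrKC => ->.
Qed.

Lemma tree_atK x : tree_at (tree_word x) (tree_len x) = x.
Proof.
case: treeP => [w rw|u l t _ t01]; first by rewrite tree_at_nat take_size.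
by rewrite -cats1 tree_at_step.
Qed.

Lemma tree_len_at w a : reduced w -> 0 <= a <= (size w)%:R -> tree_len (tree_at w a) = a.
Proof.
move=> rw aw; case: (tree_atP aw) => [n nw|u l v t wE t01].
  by rewrite /tree_len /= fb_nf_eval ?reduced_take // size_takel.
rewrite tree_len_step //; move: rw; rewrite wE -cat_rcons.
by rewrite (reduced_cat _ _ l) => /and3P[].
Qed.

Lemma tree_word_at w a : reduced w -> 0 <= a <= (size w)%:R ->
  exists2 n, tree_word (tree_at w a) = take n w & a <= n%:R.
Proof.
move=> rw aw; case: (tree_atP aw) => [n nw|u l v t wE t01].
  by exists n => //; rewrite /tree_word /= fb_nf_eval ?reduced_take.
exists (size u).+1; last by rewrite -natr1; lra.
rewrite wE -cat_rcons take_size_cat ?size_rcons // tree_word_step //.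
by move: rw; rewrite wE -cat_rcons (reduced_cat _ _ l) => /and3P[].
Qed.

(** The minimum is the Gromov product: the length of the common part of the geodesics from [1]. *)
Definition tree_dist x y : R := tree_len x + tree_len y -
  2 * Num.min (Num.min (tree_len x) (tree_len y)) (lcp (tree_word x) (tree_word y))%:R.

Lemma tree_distC x y : tree_dist x y = tree_dist y x.
Proof. by rewrite /tree_dist (lcpC (tree_word x)) (addrC (tree_len x)) (minC (tree_len x)). Qed.

(** The tree words of the two points are prefixes of [w] and [w'] of lengths at least [a] and [b],
    so cutting there cannot change a minimum that already involves [a] and [b]. *)
Lemma tree_dist_at w w' a b : reduced w -> reduced w' ->
    0 <= a <= (size w)%:R -> 0 <= b <= (size w')%:R ->
  tree_dist (tree_at w a) (tree_at w' b) = a + b - 2 * Num.min (Num.min a b) (lcp w w')%:R.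
Proof.
move=> rw rw' aw bw'; rewrite /tree_dist !tree_len_at //.
have [n -> an] := tree_word_at rw aw; have [m -> bm] := tree_word_at rw' bw'.
congr (_ - 2 * _); rewrite lcp_take !natr_minn [LHS]minA; congr Num.min.
by apply: min_l; rewrite le_min !ge_min an bm orbT.
Qed.

End Tree.

Section TreeMetric.
Variables (R : realType) (G : groupType) (k : nat) (B : free_basis G k).
Local Notation x_ := (fb_elt B).
Local Notation ev := (eval_word x_).
Local Notation nf := (fb_nf B).
Local Notation rose := (rose R k).
Local Notation T := (G * rose)%type.
Local Notation dist := (@tree_dist R G k B).
Local Notation len := (tree_len B).
Local Notation twd := (tree_word B).
Implicit Types (x y : T) (z : rose) (g h : G) (w : word 'I_k) (a b t s : R).

Lemma tree_distxx x : dist x x = 0.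
Proof.
rewrite /tree_dist lcpuu minxx min_l ?tree_len_le //; lra.
Qed.

Lemma tree_dist_triangle y x (z : T) : dist x z <= dist x y + dist y z.
Proof.
have : (Num.min (lcp (twd x) (twd y))%:R (lcp (twd y) (twd z))%:R <= (lcp (twd x) (twd z))%:R :> R).
  by rewrite -natr_minn ler_nat lcp_ultra.
rewrite /tree_dist; move: (lcp _ _)%:R (lcp _ _)%:R (lcp _ _)%:R => p q r pqr.
move: (len x) (len y) (len z) => a b c.
(* [m1], [m2], [m3] are the Gromov products of [(x, y)], [(y, z)], [(x, z)]. The claim follows from
   [min m1 m2 <= m3] together with [m1, m2 <= len y]. *)
set m3 := Num.min _ p; set m2 := Num.min _ q; set m1 := Num.min _ r.
have b1 : m1 <= b by rewrite /m1 !ge_min lexx !orbT.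
have b2 : m2 <= b by rewrite /m2 !ge_min lexx.
have : Num.min m1 m2 <= m3.
  rewrite /m1 /m2 /m3 !le_min -andbA; apply/and3P; split.
  - by rewrite !ge_min lexx.
  - by rewrite !ge_min lexx !orbT.
  by apply: le_trans pqr; rewrite le_min !ge_min !lexx !orbT.
by case: (lerP m1 m2); lra.
Qed.

(** The geodesic passes through the vertex at the end of the common prefix. The absolute values
    serve the case where one word is a prefix of the other and its point lies below that vertex. *)
Lemma tree_dist_neq x y : twd x <> twd y -> dist x y =
  `|len x - (lcp (twd x) (twd y))%:R| + `|len y - (lcp (twd x) (twd y))%:R|.
Proof.
move=> ne; rewrite /tree_dist.
have := tree_len_le B x; have := tree_len_le B y.
have := tree_len_gt B x; have := tree_len_gt B y.
have := lcp_leql (twd x) (twd y); have := lcp_leqr (twd x) (twd y).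
rewrite leq_eqVlt => /orP[/eqP cy|cy]; rewrite leq_eqVlt => /orP[/eqP cx|cx].
- by case: ne; apply: lcp_eq.
- have : (lcp (twd x) (twd y)).+1%:R <= (size (twd x))%:R :> R by rewrite ler_nat.
  rewrite -natr1 -cy; set c := (lcp _ _)%:R => *.
  rewrite ger0_norm ?ler0_norm; [|lra|lra].
  by rewrite /Num.min; do 2!case: ifP; lra.
- have : (lcp (twd x) (twd y)).+1%:R <= (size (twd y))%:R :> R by rewrite ler_nat.
  rewrite -natr1 -cx; set c := (lcp _ _)%:R => *.
  rewrite ler0_norm ?ger0_norm; [|lra|lra].
  by rewrite /Num.min; do 2!case: ifP; lra.
have : (lcp (twd x) (twd y)).+1%:R <= (size (twd y))%:R :> R by rewrite ler_nat.
have : (lcp (twd x) (twd y)).+1%:R <= (size (twd x))%:R :> R by rewrite ler_nat.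
rewrite -natr1; set c := (lcp _ _)%:R => *.
rewrite !ger0_norm; [|lra|lra].
by rewrite /Num.min; do 2!case: ifP; lra.
Qed.

Lemma tree_dist_eq x y : twd x = twd y -> dist x y = `|len x - len y|.
Proof.
move=> e; rewrite /tree_dist e lcpuu.
have := tree_len_le B x; have := tree_len_le B y; rewrite e.
move: (size _)%:R => c *.
by case: (lerP (len x) (len y)) => xy; rewrite min_l; lra.
Qed.

Lemma rheight_near x n : rheight x.2 <= `|len x - n%:R|.
Proof.
case: treeP => [w _|u l t _ t01] //=.
have -> : rheight (tree_step B u l t).2 = Num.min t (1 - t).
  case: l => i [] /=; rewrite rheight_petal //; last by lra.
  by rewrite subKr minC.
rewrite ge_min; case: (leqP n (size u)) => [nu|un].
  have : n%:R <= (size u)%:R :> R by rewrite ler_nat.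
  by move=> ?; apply/orP; left; rewrite ger0_norm; lra.
have : (size u).+1%:R <= n%:R :> R by rewrite ler_nat.
by rewrite -natr1 => ?; apply/orP; right; rewrite ler0_norm; lra.
Qed.

(** Points on different edges are joined through a vertex, which projects to the base point; on one
    edge, the petal parametrization is 1-Lipschitz. *)
Lemma proj_nonexpanding x y : rdist x.2 y.2 <= dist x y.
Proof.
have [e|ne] := pselect (twd x = twd y); last first.
  rewrite tree_dist_neq //; apply: le_trans (rdist_le _ _) _.
  by rewrite lerD // rheight_near.
rewrite tree_dist_eq //; case: (treeP B x) e => [w rw|u l t rul t01].
  by move=> _; rewrite rdistC rdist_base distrC rheight_near.
case: (treeP B y) => [w rw|u' l' t' rul' t01'].
  move=> _; rewrite rdist_base.
  by have := rheight_near (tree_step B u l t) (size w); rewrite tree_len_step.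
move/rcons_inj => -[-> ->]; rewrite opprD addrACA subrr add0r /tree_step.
case: l'.2; apply: le_trans (rdist_petal _ _ _) _ => //.
by rewrite (_ : 1 - t - (1 - t') = - (t - t')) ?normrN //; ring.
Qed.

(** [petal i 1] is the base point, so [(g, petal i 1)] would be the origin of the edge; the far end
    needs its own case. *)
Definition edge_pt g (i : 'I_k) t : T := if t == 1 then ((g * x_ i)%g, None) else (g, petal i t).

Lemma edge_dist g i t s : 0 <= t <= 1 -> 0 <= s <= 1 ->
  dist (edge_pt g i t) (edge_pt g i s) = `|t - s|.
Proof.
move=> t01 s01; have [v [f [rv fE fd]]] : exists v (f : R -> R), [/\ reduced v,
    forall t, 0 <= t <= 1 -> edge_pt g i t = tree_at B v (f t) /\ 0 <= f t <= (size v)%:R &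
    forall t s, `|f t - f s| = `|t - s|].
  have [e|[u e gxu]] := nf_mulx B g i.
    exists (rcons (nf g) (i, true)), (fun t => (size (nf g))%:R + t); split.
    - by rewrite -e fb_reduced.
    - move=> r r01; rewrite size_rcons -natr1; split.
        rewrite /edge_pt; have [->|r1] := eqVneq r 1.
          by rewrite natr1 -(size_rcons _ (i, true)) tree_at_nat take_size -e fb_nfK.
        have [->|r0] := eqVneq r 0.
          by rewrite addr0 tree_at_nat -cats1 take_size_cat // fb_nfK petal0.
        by rewrite -cats1 tree_at_step /tree_step /= ?fb_nfK // !lt_neqAle eq_sym r0 r1.
      by have : 0 <= (size (nf g))%:R :> R by []; lra.
    by move=> r r'; rewrite opprD addrACA subrr add0r.
  exists (nf g), (fun t => (size u)%:R + (1 - t)); split.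
  - exact: fb_reduced.
  - move=> r r01; rewrite e size_rcons -natr1; split; last first.
      by have : 0 <= (size u)%:R :> R by []; lra.
    rewrite /edge_pt; have [->|r1] := eqVneq r 1.
      by rewrite subrr addr0 tree_at_nat -cats1 take_size_cat // gxu.
    have [->|r0] := eqVneq r 0.
      by rewrite subr0 natr1 -(size_rcons _ (i, false)) tree_at_nat take_size -e fb_nfK petal0.
    rewrite -cats1 tree_at_step /tree_step /=; first by rewrite subKr -e fb_nfK.
    by have : 0 < r < 1; [rewrite !lt_neqAle eq_sym r0 r1|lra].
  move=> r r'; rewrite -normrN; congr `|_|; ring.
have [-> ft] := fE _ t01; have [-> fs] := fE _ s01.
rewrite tree_dist_at // lcpuu -fd; move: (f t) (f s) ft fs => a b /andP[_ av] /andP[_ bv].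
by case: (lerP a b) => ab; rewrite min_l; lra.
Qed.

Lemma edge_pt0 g i : edge_pt g i 0 = (g, None).
Proof. by rewrite /edge_pt eq_sym oner_eq0 petal0. Qed.

Lemma edge_pt1 g i : edge_pt g i 1 = ((g * x_ i)%g, None).
Proof. by rewrite /edge_pt eqxx. Qed.

Lemma edge_ptE g i t : t < 1 -> edge_pt g i t = (g, petal i t).
Proof. by move=> t1; rewrite /edge_pt lt_eqF. Qed.

(** The nearer end of the edge depends on [z] only, hence is chosen alike in all sheets. *)
Lemma to_vertex z : exists2 f : G -> G, (forall g h, f (g * h)%g = (g * f h)%g) &
  forall g, dist (g, z) (f g, None) <= rheight z.
Proof.
case: (roseP z) => [|i t t01]; first by exists id => // g; rewrite tree_distxx.
rewrite rheight_petal //; case: (lerP t (1 - t)) => ht.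
  exists id => // g; rewrite -edge_ptE; last lra.
  by rewrite -(edge_pt0 g i) edge_dist ?subr0 ?ger0_norm; lra.
exists (fun g => (g * x_ i)%g) => [g h|g]; first by rewrite mulgA.
rewrite -edge_ptE; last lra.
by rewrite -(edge_pt1 g i) edge_dist ?ler0_norm; lra.
Qed.

(** The same [a] lifts the move from [z] to [z'] at every sheet [g], so that lifting commutes with the
    left translations. *)
Lemma holonomy z z' : exists a : G, forall g, dist (g, z) ((g * a)%g, z') <= rdist z z'.
Proof.
have [->|[i [t [s [-> -> t01 s01 ->]]]]] := rdist_cases z z'; last first.
  exists 1%g => g; rewrite mulg1 -!edge_ptE; try lra.
  by rewrite edge_dist //; lra.
have [f fM fd] := to_vertex z; have [f' f'M f'd] := to_vertex z'.
(* The path goes from [(g, z)] to its near vertex [f g], then to the point over [z'] whose near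
   vertex under [f'] is [f g]. *)
exists (f 1 * (f' 1)^-1)%g => g; rewrite mulgA -fM mulg1.
apply: le_trans (tree_dist_triangle (f g, None) _ _) _; rewrite lerD //.
rewrite tree_distC; have := f'd (f g * (f' 1)^-1)%g.
suff -> : f' (f g * (f' 1)^-1)%g = f g by [].
by rewrite -[X in f' X]mulg1 f'M mulgVK.
Qed.

Lemma vertex_dist g h : g <> h -> 1 <= dist (g, None) (h, None).
Proof.
move=> gh; have ne : nf g <> nf h by move/fb_nf_inj.
rewrite tree_dist_neq // /tree_len /tree_word /=; set c := lcp _ _.
have cg : (c <= size (nf g))%N := lcp_leql _ _.
have ch : (c <= size (nf h))%N := lcp_leqr _ _.
rewrite !ger0_norm ?subr_ge0 ?ler_nat // -!natrB // -natrD ler1n.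
rewrite addn_gt0 !subn_gt0 !ltn_neqAle cg ch !andbT -negb_and.
by apply: contra_notN ne => /andP[/eqP e1 /eqP e2]; exact: lcp_eq.
Qed.

(** For height at most 1/4, the near vertices are at distance at least 1 and lose at most 1/4 on
    each side. Otherwise both points are more than 1/4 from every vertex, and sharing a tree word
    would force [g = h]. *)
Lemma fiber_dist g h z : g <> h -> 2^-1 <= dist (g, z) (h, z).
Proof.
move=> gh; have [small|big] := lerP (rheight z) (4^-1).
  have [f fM fd] := to_vertex z.
  have ne : f g <> f h.
    rewrite -[g]mulg1 -[h]mulg1 !fM => /(can_inj (mulgK _)); exact: gh.
  have := vertex_dist ne; have := fd g; have := fd h.
  have := tree_dist_triangle (g, z) (f g, None) (f h, None).
  have := tree_dist_triangle (h, z) (g, z) (f h, None).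
  rewrite (tree_distC B (f g, None) (g, z)); lra.
have [e|ne] := pselect (twd (g, z) = twd (h, z)); last first.
  rewrite tree_dist_neq //.
  have := rheight_near (g, z) (lcp (twd (g, z)) (twd (h, z))).
  have := rheight_near (h, z) (lcp (twd (g, z)) (twd (h, z))).
  by rewrite /=; lra.
case: gh; move: big e; case: (roseP z) => [/= big _|i t t01 _]; first by exfalso; lra.
rewrite /tree_word /= petalE.
have [eg|[u eg gx]] := nf_mulx B g i; have [eh|[v eh hx]] := nf_mulx B h i.
- by rewrite eg eh !size_rcons !leqnn => /rcons_inj [] /fb_nf_inj.
- rewrite eg hx fb_nf_eval; last by have := fb_reduced B h; rewrite eh reduced_rcons => /andP[].
  by rewrite eh !size_rcons leqnn ltnNge leqnSn /= => /rcons_inj [].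
- rewrite eh gx fb_nf_eval; last by have := fb_reduced B g; rewrite eg reduced_rcons => /andP[].
  by rewrite eg !size_rcons leqnn ltnNge leqnSn /= => /rcons_inj [].
rewrite gx hx !fb_nf_eval.
- have -> : (size (nf g) < size u)%N = false by rewrite eg size_rcons ltnNge leqnSn.
  have -> : (size (nf h) < size v)%N = false by rewrite eh size_rcons ltnNge leqnSn.
  exact: fb_nf_inj.
- by have := fb_reduced B h; rewrite eh reduced_rcons => /andP[].
by have := fb_reduced B g; rewrite eg reduced_rcons => /andP[].
Qed.

Lemma fiber_eq x y : x.2 = y.2 -> dist x y < 2^-1 -> x = y.
Proof.
case: x y => [g z] [h z'] /= <- xy; congr (_, _); apply: contrapT => gh.
by have := fiber_dist z gh; rewrite leNgt xy.
Qed.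

(** Within 1/4 of [x], [y] is the endpoint of the holonomy move from [x], as both are closer than
    1/2 in one fiber; holonomy commutes with left translation. *)
Lemma left_translation g x y : dist x y < 4^-1 ->
  dist ((g * x.1)%g, x.2) ((g * y.1)%g, y.2) <= dist x y.
Proof.
move=> xy; have xy' := proj_nonexpanding x y.
have [a ad] := holonomy x.2 y.2.
have e : ((x.1 * a)%g, y.2) = y.
  apply: fiber_eq => //; apply: le_lt_trans (tree_dist_triangle x _ _) _.
  rewrite tree_distC; have := ad x.1; rewrite -surjective_pairing; lra.
rewrite -{1}e /= mulgA; exact: le_trans (ad _) xy'.
Qed.

Definition tree_scale x s : T := tree_at B (twd x) (s * len x).

Lemma tree_scale0 x : tree_scale x 0 = (1%g, None).
Proof. by rewrite /tree_scale mul0r (tree_at_nat _ _ _ 0) take0 eval_word_nil. Qed.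

Lemma tree_scale1 x : tree_scale x 1 = x.
Proof. by rewrite /tree_scale mul1r tree_atK. Qed.

Lemma tree_scale_base s : tree_scale (1%g, None) s = (1%g, None).
Proof.
rewrite /tree_scale /tree_len /tree_word /= fb_nf1 mulr0.
by rewrite (tree_at_nat _ _ _ 0) eval_word_nil.
Qed.

(** The lengths of the scaled points differ by at most [|s - s'| * len x] plus one [dist x y]; what
    they travel beyond the branching costs at most another [dist x y]. *)
Lemma tree_scale_dist x y s s' : 0 <= s <= 1 -> 0 <= s' <= 1 ->
  dist (tree_scale x s) (tree_scale y s') <= 2 * dist x y + `|s - s'| * len x.
Proof.
move=> s01 s01'; have lx := tree_len_ge0 B x; have ly := tree_len_ge0 B y.
have sx : s * len x <= len x by rewrite ler_piMl; lra.
have sy : s' * len y <= len y by rewrite ler_piMl; lra.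
have sx0 : 0 <= s * len x by rewrite mulr_ge0; lra.
have sy0 : 0 <= s' * len y by rewrite mulr_ge0; lra.
rewrite tree_dist_at ?tree_word_reduced //; last 2 first.
- by rewrite sx0 (le_trans sx) // tree_len_le.
- by rewrite sy0 (le_trans sy) // tree_len_le.
have lxy : `|len x - len y| <= dist x y.
  by rewrite /tree_dist; case: (lerP (len x) (len y)) => ?; case: (lerP _ (lcp _ _)%:R) => ?; lra.
have ab : `|s * len x - s' * len y| <= `|s - s'| * len x + dist x y.
  have -> : s * len x - s' * len y = (s - s') * len x + s' * (len x - len y) by ring.
  apply: le_trans (ler_normD _ _) _; rewrite !normrM (ger0_norm lx) lerD2l.
  rewrite (ger0_norm (_ : 0 <= s')); last lra.
  by apply: le_trans lxy; rewrite ler_piMl //; lra.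
have p0 : 0 <= `|s - s'| * len x by rewrite mulr_ge0.
move: ab; rewrite ler_norml /tree_dist => /andP[].
move: p0 sx sy sx0 sy0 lx ly.
move: (`|s - s'| * len x) (s * len x) (s' * len y) => p a b.
move: (len x) (len y) (lcp _ _)%:R => l l' c.
case: (lerP l l') => ?; case: (lerP a b) => ?.
- by case: (lerP l c) => ?; case: (lerP a c) => ?; lra.
- by case: (lerP l c) => ?; case: (lerP b c) => ?; lra.
- by case: (lerP l' c) => ?; case: (lerP a c) => ?; lra.
by case: (lerP l' c) => ?; case: (lerP b c) => ?; lra.
Qed.

End TreeMetric.

(** * Lifting *)

Section DistContinuity.
Variable R : realType.

(** Continuity on [A] of a function into a set [U] that carries a mere distance function: the tree needs no
    topology of its own. *)
Definition dcts (V : topologicalType) (U : Type) (d : U -> U -> R) (A : set V) (F : V -> U) :=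
  forall x, A x -> forall e, 0 < e -> \forall y \near x, A y -> d (F x) (F y) < e.

Lemma within_dcts (V : topologicalType) (X : metricType R) (A : set V) (f : V -> X) :
  {within A, continuous f} <-> dcts mdist A f.
Proof.
rewrite subspace_continuousP; split=> fc x Ax.
  move=> e e0; have /metricType_numDomainType.cvgrPdist_lt /(_ e e0) := fc x Ax.
  by rewrite near_withinE.
by apply/metricType_numDomainType.cvgrPdist_lt => e e0; rewrite near_withinE; exact: fc.
Qed.

Lemma dcts_cst (V : topologicalType) (U : Type) (d : U -> U -> R) (A : set V) (u : U) :
  d u u = 0 -> dcts d A (fun=> u).
Proof. by move=> uu x _ e e0; apply: nearW => y _; rewrite uu. Qed.

Lemma dcts_comp (V V' : topologicalType) (U : Type) (d : U -> U -> R) (A : set V) (A' : set V')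
    (h : V -> V') (F : V' -> U) :
  continuous h -> (forall x, A x -> A' (h x)) -> dcts d A' F -> dcts d A (F \o h).
Proof.
move=> hc hA Fc x Ax e e0; have := hc x _ (Fc _ (hA _ Ax) _ e0).
rewrite /nbhs /=; apply: filterS => y Fy Ay; apply: Fy; exact: hA.
Qed.

Lemma dcts_le (V : topologicalType) (U U' : Type) (d : U -> U -> R) (d' : U' -> U' -> R)
    (A : set V) (F : V -> U) (F' : V -> U') :
    (forall x y, A x -> A y -> d' (F' x) (F' y) <= d (F x) (F y)) ->
  dcts d A F -> dcts d' A F'.
Proof.
move=> le Fc x Ax e e0; apply: filterS (Fc x Ax e e0) => y Fy Ay.
exact: le_lt_trans (le _ _ Ax Ay) (Fy Ay).
Qed.

Lemma dcts_paste (V : topologicalType) (U : Type) (d : U -> U -> R) (A : set V)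
    (h : V -> R) (c : R) (f g : V -> U) :
    continuous h -> (forall x, A x -> h x = c -> f x = g x) -> dcts d A f -> dcts d A g ->
  dcts d A (fun x => if h x <= c then f x else g x).
Proof.
move=> hc fg fc gc x Ax e e0; have [xc|xc] := ltrP (h x) c.
  have lt_c : \forall y \near x, h y < c by exact: (cvgr_lt (h x) (hc x)).
  apply: filterS2 lt_c (fc x Ax e e0) => y yc fy Ay.
  by rewrite !ltW //; exact: fy.
move: xc; rewrite le_eqVlt => /orP[/eqP xc|xc].
  apply: filterS2 (fc x Ax e e0) (gc x Ax e e0) => y fy gy Ay.
  rewrite -xc lexx; case: ifP => _; first exact: fy.
  by rewrite (fg x Ax (esym xc)); exact: gy.
have gt_c : \forall y \near x, c < h y by exact: (cvgr_gt (h x) (hc x)).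
apply: filterS2 gt_c (gc x Ax e e0) => y yc gy Ay.
by rewrite !leNgt xc yc; exact: gy.
Qed.

Lemma dcts_uniform (V : normedModType R) (U : Type) (d : U -> U -> R) (K : set V) (F : V -> U) :
    (forall x y, d x y = d y x) -> (forall y x z, d x z <= d x y + d y z) ->
    compact K -> dcts d K F ->
  forall e, 0 < e -> exists2 r, 0 < r &
    forall x y, K x -> K y -> `|x - y| < r -> d (F x) (F y) < e.
Proof.
move=> dC dT Kc Fc e e0.
pose P (r : R) x := forall y, K x -> K y -> `|x - y| < r -> d (F x) (F y) < e.
have /(_ R (0^'+) P _) near0 := (compact_near_coveringP K).1 Kc.
have {}near0 : \forall r \near 0^'+, forall x, K x -> P r x.
  apply: near0 => x Kx; have e20 : 0 < e / 2 by rewrite divr_gt0.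
  have /nbhs_ballP[r /= r0 rb] := Fc x Kx _ e20.
  have r20 : 0 < r / 2 by rewrite divr_gt0.
  exists (ball x (r / 2), [set s | 0 < s < r / 2]) => /=.
    split; first exact: nbhsx_ballx.
    near=> s; apply/andP; split; first by near: s; exact: nbhs_right_gt.
    by near: s; exact: nbhs_right_lt.
  move=> [x' s] /= [xx' /andP[s0 sr]] y Kx' Ky x'y.
  have Fx' : d (F x) (F x') < e / 2.
    by apply: rb => //; apply: le_ball xx'; lra.
  have Fy : d (F x) (F y) < e / 2.
    apply: rb => //; rewrite -ball_normE /= in xx' *.
    have le := ler_normD (x - x') (x' - y); rewrite addrA subrK in le.
    by apply: le_lt_trans le _; rewrite [r]splitr ltrD // (lt_trans x'y).
  by apply: le_lt_trans (dT (F x) _ _) _; rewrite (dC (F x')) [e]splitr ltrD.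
near (0 : R)^'+ => r; exists r; first by near: r; exact: nbhs_right_gt.
move=> x y Kx; have /(_ x Kx y Kx) : forall x, K x -> P r x by near: r; exact: near0.
by [].
Unshelve. all: by end_near. Qed.

End DistContinuity.

Section Lifting.
Variables (R : realType) (G : groupType) (k : nat) (B : free_basis G k).
Local Notation rose := (rose R k).
Local Notation T := (G * rose)%type.
Local Notation dist := (@tree_dist R G k B).

Definition star_shaped (V : normedModType R) (K : set V) :=
  K 0 /\ forall x t, K x -> 0 <= t <= 1 -> K (t *: x).

Lemma lift_exists x z : exists y, y.2 = z /\ dist x y <= rdist x.2 z.
Proof.
have [a ad] := holonomy B x.2 z; exists ((x.1 * a)%g, z); split=> //.
by have := ad x.1; rewrite -surjective_pairing.
Qed.

(** A lift near [F x] is picked for each [x] separately; continuity is automatic, because the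
    competing lifts at [y] are within 1/16 + 1/8 + 1/16 + 1/8 < 1/2 of each other. *)
Lemma lift_step (V : topologicalType) (A : set V) (F : V -> T) (f : V -> rose) :
    dcts dist A F -> dcts rdist A f -> (forall x, A x -> rdist (F x).2 (f x) < 8^-1) ->
  exists F' : V -> T, [/\ dcts dist A F', forall x, (F' x).2 = f x &
    forall x, A x -> dist (F x) (F' x) < 8^-1].
Proof.
move=> Fc fc Ff.
have [F' F'E] := choice (fun x => lift_exists (F x) (f x)).
exists F'; split=> [x Ax e e0|x|x Ax].
- have e16 : 0 < Num.min e 16^-1 :> R by rewrite lt_min e0 invr_gt0 ltr0n.
  have p16 : 0 < 16^-1 :> R by rewrite invr_gt0 ltr0n.
  apply: filterS2 (Fc x Ax _ p16) (fc x Ax _ e16) => y Fy fy Ay.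
  have [x2 xd] := F'E x; have [y2 yd] := F'E y.
  have {Fy} Fy := Fy Ay; have := fy Ay; rewrite lt_min => /andP[fe f16].
  have := Ff x Ax; have := Ff y Ay => ffx ffy.
  have [z [z2 zd]] := lift_exists (F' x) (f y); rewrite x2 in zd.
  suff <- : z = F' y by lra.
  apply: (@fiber_eq _ _ _ B); first by rewrite z2 y2.
  have := tree_dist_triangle B (F' x) z (F' y).
  have := tree_dist_triangle B (F x) (F' x) (F' y).
  have := tree_dist_triangle B (F y) (F x) (F' y).
  rewrite (tree_distC B z (F' x)) (tree_distC B (F' x) (F x)); lra.
- by have [] := F'E x.
by have [_ l] := F'E x; apply: le_lt_trans l (Ff x Ax).
Qed.

Lemma lift_steps (V : topologicalType) (A : set V) (x0 : V) (f : nat -> V -> rose) (F : V -> T) n :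
    A x0 -> (forall i, dcts rdist A (f i)) -> (forall i, f i x0 = f 0%N x0) ->
    (forall i x, A x -> rdist (f i x) (f i.+1 x) < 8^-1) ->
    dcts dist A F -> (forall x, (F x).2 = f 0%N x) ->
  exists F' : V -> T, [/\ dcts dist A F', forall x, (F' x).2 = f n x & F' x0 = F x0].
Proof.
move=> Ax0 fc f0 ff Fc Ff; elim: n => [|n [F' [F'c F'f F'0]]]; first by exists F.
have [|F'' [F''c F''f F'F'']] := lift_step F'c (fc n.+1).
  by move=> x Ax; rewrite F'f; exact: ff.
exists F''; split=> //; rewrite -F'0; apply: (@fiber_eq _ _ _ B).
  by rewrite F''f F'f !f0.
rewrite tree_distC; apply: lt_trans (F'F'' _ Ax0) _; lra.
Qed.

(** The homotopy [f (i / n *: x)] from a constant map to [f] is lifted in [n] small steps. *)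
Lemma lift_map (V : normedModType R) (K : set V) (f : V -> rose) (g : G) :
    compact K -> star_shaped K -> dcts rdist K f ->
  exists F : V -> T, [/\ dcts dist K F, forall x, K x -> (F x).2 = f x & F 0 = (g, f 0)].
Proof.
move=> Kc [K0 Ks] fc.
have e8 : 0 < 8^-1 :> R by rewrite invr_gt0 ltr0n.
have [r r0 fr] := dcts_uniform (@rdistC R k) (@rdist_triangle R k) Kc fc e8.
have [M M0 KM] : exists2 M, 0 < M & forall x, K x -> `|x| <= M.
  have /compact_bounded[M [Mr MK]] := Kc.
  exists (`|M| + 1); first by rewrite ltr_pwDr.
  by apply: MK; rewrite (le_lt_trans (ler_norm _)) // ltrDl.
pose n := (Num.truncn (M / r)).+1.
have nr : M / n%:R < r.
  by rewrite ltr_pdivrMr ?ltr0n // mulrC -ltr_pdivrMr //; exact: truncnS_gt.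
(* Capped at 1, since [lift_steps] wants small moves along the whole infinite sequence. *)
pose c i : R := Num.min 1 (i%:R / n%:R).
have c01 i : 0 <= c i <= 1 by rewrite /c le_min ge_min lexx ler01 divr_ge0.
have cS i : `|c i - c i.+1| <= n%:R^-1.
  have n0 : 0 < n%:R^-1 :> R by rewrite invr_gt0 ltr0n.
  rewrite /c -natr1 mulrDl mul1r.
  by case: (lerP 1 (i%:R / n%:R)) => ?; case: (lerP 1 (i%:R / n%:R + n%:R^-1)) => ?;
    rewrite ler_norml; lra.
pose h i x := f (c i *: x).
have [||||||F [Fc Ff F0]] := @lift_steps V K 0 h (fun=> (g, f 0)) n.
- exact: K0.
- move=> i; apply: (dcts_comp _ _ fc) => [x|x Kx]; last exact: Ks.
  exact: scaler_continuous.
- by move=> i; rewrite /h !scaler0.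
- move=> i x Kx; apply: fr; [exact: Ks|exact: Ks|].
  rewrite -scalerBl normrZ; apply: le_lt_trans nr.
  by rewrite mulrC ler_pM // KM.
- by apply: dcts_cst; rewrite tree_distxx.
- by move=> x; rewrite /h /c mul0r min_r // scale0r.
exists F; split=> // x Kx; rewrite Ff /h.
by rewrite /c divff ?pnatr_eq0 // minxx scale1r.
Qed.

(** Equality spreads by steps of [m / 2]: from a common value each lift moves by less than 1/4, so
    the two remain closer than 1/2 in one fiber. *)
Lemma lift_unique (F F' : R -> T) :
    dcts dist (@I01 R) F -> dcts dist (@I01 R) F' -> (forall t, I01 t -> (F t).2 = (F' t).2) ->
    F 0 = F' 0 ->
  forall t, I01 t -> F t = F' t.
Proof.
move=> Fc F'c FF' F0.
have e4 : 0 < 4^-1 :> R by rewrite invr_gt0 ltr0n.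
have I01c : compact (@I01 R) by exact: segment_compact.
have unif := dcts_uniform (tree_distC B) (tree_dist_triangle B) I01c.
have [r r0 Fr] := unif _ Fc _ e4; have [r' r'0 Fr'] := unif _ F'c _ e4.
pose m := Num.min r r'; have m0 : 0 < m by rewrite lt_min r0.
have main n t : I01 t -> t <= n%:R * (m / 2) -> F t = F' t.
  elim: n t => [|n IHn] t; rewrite /I01 /= in_itv /= => /andP[t0 t1].
    by rewrite mul0r => t0'; have -> : t = 0 by apply/eqP; rewrite eq_le t0'.
  rewrite -natr1 mulrDl mul1r => tn; pose s := Num.max 0 (t - m / 2).
  have Is : I01 s by rewrite /I01 /= in_itv /= /s; case: (lerP 0 (t - m / 2)); lra.
  have It : I01 t by rewrite /I01 /= in_itv /= t0.
  have sn : s <= n%:R * (m / 2).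
    rewrite /s ge_max; apply/andP; split; last by lra.
    by rewrite mulr_ge0 // ltW // divr_gt0.
  have st : `|s - t| < m.
    by rewrite /s; case: (lerP 0 (t - m / 2)) => ?; rewrite ltr_norml; lra.
  have Fs := IHn s Is sn. apply: (@fiber_eq _ _ _ B); first exact: FF'.
  have := tree_dist_triangle B (F s) (F t) (F' t).
  have : dist (F s) (F t) < 4^-1 by apply: Fr => //; rewrite (lt_le_trans st) // ge_min lexx.
  have : dist (F' s) (F' t) < 4^-1.
    by apply: Fr' => //; rewrite (lt_le_trans st) // ge_min lexx orbT.
  rewrite Fs (tree_distC B (F t) (F' s)); lra.
move=> t It; apply: (main (Num.truncn (2 / m)).+1) => //.
move: It; rewrite /I01 /= in_itv /= => /andP[_ t1]; apply: le_trans t1 _.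
rewrite mulrA ler_pdivlMr // mul1r -ler_pdivrMr //; exact/ltW/truncnS_gt.
Qed.

Lemma lift_const_path (V : topologicalType) (K : set V) (F : V -> T) (h : R -> V) :
    dcts dist K F -> continuous h -> (forall t, I01 t -> K (h t)) ->
    (forall t, I01 t -> (F (h t)).2 = (F (h 0)).2) ->
  F (h 1) = F (h 0).
Proof.
move=> Fc hc hK Fh.
have e := @lift_unique (F \o h) (fun=> F (h 0)).
apply: e => //.
- exact: dcts_comp hc hK Fc.
- by apply: dcts_cst; rewrite tree_distxx.
by rewrite /I01 /= in_itv /= ler01 lexx.
Qed.

End Lifting.

(** * Homotopy groups of the rose *)

Section Clip.
Variable R : realType.

(** Clipped parameters are continuous on all of [R] and always in range, so pieces of a homotopy can
    be pasted without domain conditions. *)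
Definition clip (r : R) : R := Num.max 0 (Num.min 1 r).

Lemma clip_continuous : continuous clip.
Proof.
have lip r s : `|clip r - clip s| <= `|r - s|.
  rewrite /clip ler_norml; case: (lerP r s) => rs;
  case: (lerP 1 r) => ?; case: (lerP 1 s) => ?; rewrite ?(max_r ler01);
  try (case: (lerP 0 r) => ?); try (case: (lerP 0 s) => ?); lra.
move=> x; apply/cvgrPdist_lt => e e0; near=> y; apply: le_lt_trans (lip x y) _.
near: y; exact: cvgr_dist_lt.
Unshelve. all: by end_near. Qed.

Lemma clip_affine_continuous (V : topologicalType) (h : V -> R) a b :
  continuous h -> continuous (fun z => clip (a + b * h z)).
Proof.
move=> hc z; apply: (@continuous_comp _ _ _ (fun z => a + b * h z) clip); last first.
  exact: clip_continuous.
by apply: cvgD; [exact: cvg_cst|apply: cvgM; [exact: cvg_cst|exact: hc]].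
Qed.

Lemma clip_affine1_continuous a b : continuous (fun t : R => clip (a + b * t)).
Proof. by apply: (@clip_affine_continuous _ id) => t; exact: cvg_id. Qed.

Lemma clip_ge0 r : 0 <= clip r.
Proof. by rewrite /clip le_max lexx. Qed.

Lemma clip_itv r : 0 <= clip r <= 1.
Proof. by rewrite clip_ge0 /clip ge_max ge_min ler01 lexx. Qed.

Lemma clip_I01 r : I01 (clip r).
Proof. by rewrite /I01 /= in_itv /= clip_itv. Qed.

Lemma clip_id r : 0 <= r <= 1 -> clip r = r.
Proof. by move=> /andP[r0 r1]; rewrite /clip min_r // max_r. Qed.

Lemma clip_le0 r : r <= 0 -> clip r = 0.
Proof. by move=> r0; rewrite /clip max_l // ge_min r0 orbT. Qed.

Lemma clip_ge1 r : 1 <= r -> clip r = 1.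
Proof. by move=> r1; rewrite /clip min_l // max_r. Qed.

Lemma I01E (t : R) : I01 t = (0 <= t <= 1).
Proof. by rewrite /I01 /= in_itv. Qed.

End Clip.

Section Aspherical.
Variables (R : realType) (G : groupType) (k : nat) (B : free_basis G k).
Local Notation rose := (rose R k).
Local Notation T := (G * rose)%type.
Local Notation dist := (@tree_dist R G k B).
Local Notation scale := (@tree_scale R G k B).
Local Notation base := ((1%g, None) : T).
Local Notation I01 := (@I01 R).

Lemma scale_dcts (V : topologicalType) (A : set V) (F : V -> T) (s : V -> R) :
    dcts dist A F -> continuous s -> (forall x, A x -> 0 <= s x <= 1) ->
  dcts dist A (fun x => scale (F x) (s x)).
Proof.
move=> Fc sc s01 x Ax e e0; have l0 := tree_len_ge0 B (F x).
have l1 : 0 < tree_len B (F x) + 1 by lra.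
have e4 : 0 < e / 4 by rewrite divr_gt0.
have d0 : 0 < e / 2 / (tree_len B (F x) + 1) by rewrite !divr_gt0.
have snear : \forall y \near x, `|s x - s y| < e / 2 / (tree_len B (F x) + 1).
  by have /cvgrPdist_lt := sc x; exact.
apply: filterS2 (Fc x Ax _ e4) snear => y Fy sy Ay.
apply: le_lt_trans (tree_scale_dist _ _ _ (s01 x Ax) (s01 y Ay)) _.
have : `|s x - s y| * tree_len B (F x) <= `|s x - s y| * (tree_len B (F x) + 1).
  by rewrite ler_wpM2l //; lra.
have := Fy Ay; rewrite ltr_pdivlMr // in sy; lra.
Qed.

Lemma proj_dcts (V : topologicalType) (A : set V) (F : V -> T) :
  dcts dist A F -> dcts rdist A (fun x => (F x).2).
Proof. by apply: dcts_le => x y _ _; exact: proj_nonexpanding. Qed.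

Lemma translate_dcts (V : topologicalType) (A : set V) (F : V -> T) g :
  dcts dist A F -> dcts dist A (fun x => ((g * (F x).1)%g, (F x).2)).
Proof.
move=> Fc x Ax e e0; have e4 : 0 < Num.min e 4^-1 by rewrite lt_min e0 invr_gt0 ltr0n.
apply: filterS (Fc x Ax _ e4) => y Fy Ay; have := Fy Ay; rewrite lt_min => /andP[Fe F4].
exact: le_lt_trans (left_translation g F4) Fe.
Qed.

Lemma I01_star : star_shaped I01.
Proof.
split=> [|x t]; rewrite !I01E ?lexx ?ler01 // => /andP[x0 x1] /andP[t0 t1].
by rewrite mulr_ge0 //= -[leRHS]mulr1 ler_pM.
Qed.

Lemma I01_compact : compact I01.
Proof. exact: segment_compact. Qed.

Lemma rose_path_connected : path_connected_space R rose.
Proof.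
move=> x y.
exists (fun t => if t <= 2^-1 then (scale (1%g, x) (clip (1 + (- 2) * t))).2
                 else (scale (1%g, y) (clip (- 1 + 2 * t))).2).
  apply/within_dcts; apply: (@dcts_paste _ _ _ _ _ id) => //.
  - by move=> t; exact: cvg_id.
  - move=> t _ ->; rewrite !clip_le0; [|lra|lra].
    by rewrite !tree_scale0.
  - apply: proj_dcts; apply: scale_dcts => [||t _]; [|exact: clip_affine1_continuous|exact: clip_itv].
    by apply: dcts_cst; rewrite tree_distxx.
  apply: proj_dcts; apply: scale_dcts => [||t _]; [|exact: clip_affine1_continuous|exact: clip_itv].
  by apply: dcts_cst; rewrite tree_distxx.
split.
  rewrite invr_ge0 ler0n mulr0 addr0 clip_id ?ler01 ?lexx //.
  by rewrite tree_scale1.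
rewrite ifF; last by apply/negbTE; rewrite -ltNge; lra.
by rewrite clip_ge1 ?tree_scale1 //; lra.
Qed.

Definition lifts_to (p : R -> rose) (g : G) := exists F : R -> T,
  [/\ dcts dist I01 F, forall t, I01 t -> (F t).2 = p t, F 0 = base & F 1 = (g, None)].

Lemma lifts_to_ex p : is_loop (None : rose) p -> exists g, lifts_to p g.
Proof.
move=> [/within_dcts pc p0 p1].
have [F [Fc Fp F0]] := lift_map B 1%g I01_compact I01_star pc.
exists (F 1).1, F; rewrite F0 p0; split=> //.
by rewrite -p1 -Fp ?I01E ?lexx ?ler01 // -surjective_pairing.
Qed.

Lemma lifts_to_uniq p g h : lifts_to p g -> lifts_to p h -> g = h.
Proof.
move=> [F [Fc Fp F0 F1]] [F' [F'c F'p F'0 F'1]].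
have : F 1 = F' 1.
  apply: (lift_unique Fc F'c); rewrite ?F0 ?F'0 ?I01E ?lexx ?ler01 // => t It.
  by rewrite Fp ?F'p.
by rewrite F1 F'1 => -[].
Qed.

(** The second lift is translated by [g], so that it starts where the first one ends. *)
Lemma lifts_to_cat p q g h : lifts_to p g -> lifts_to q h -> lifts_to (loop_cat p q) (g * h)%g.
Proof.
move=> [F [Fc Fp F0 F1]] [F' [F'c F'p F'0 F'1]].
pose F'' t := if t <= 2^-1 then F (clip (0 + 2 * t)) else
  ((g * (F' (clip (- 1 + 2 * t))).1)%g, (F' (clip (- 1 + 2 * t))).2).
exists F''; split.
- apply: (@dcts_paste _ _ _ _ _ id) => //.
  + by move=> t; exact: cvg_id.
  + move=> t _ ->; rewrite clip_ge1 ?clip_le0; [|lra|lra].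
    by rewrite F1 F'0 mulg1.
  + apply: (dcts_comp (F := F) _ _ Fc) => [|t _]; [exact: clip_affine1_continuous|exact: clip_I01].
  apply: translate_dcts; apply: (dcts_comp (F := F') _ _ F'c) => [|t _]; [exact: clip_affine1_continuous|exact: clip_I01].
- move=> t; rewrite I01E => /andP[t0 t1]; rewrite /F'' /loop_cat; case: lerP => ht /=.
    have t2 : 0 <= 2 * t <= 1 by lra.
    by rewrite add0r clip_id // Fp // I01E.
  have t2 : 0 <= 2 * t - 1 <= 1 by lra.
  by rewrite addrC clip_id // F'p // I01E.
- by rewrite /F'' invr_ge0 ler0n mulr0 addr0 clip_le0.
rewrite /F'' ifF; last by apply/negbTE; rewrite -ltNge; lra.
by rewrite clip_ge1 ?F'1 //; lra.
Qed.

Definition monodromy (p : R -> rose) : G := xget 1%g [set g | lifts_to p g].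

Lemma monodromyE p g : lifts_to p g -> monodromy p = g.
Proof.
move=> pg; apply: (@lifts_to_uniq p) => //.
exact: (@xgetPex _ 1%g [set g | lifts_to p g] (ex_intro _ g pg)).
Qed.

Lemma monodromyP p : is_loop (None : rose) p -> lifts_to p (monodromy p).
Proof. by case/lifts_to_ex => g pg; rewrite (monodromyE pg). Qed.

(** On [s <= 1/2], [(u, v)] moves from the side [v = 1] of the unit square to its side [u = 1]
    with its endpoint at the corner [(1, 1)] and its origin on [u v = 0]: [scale (F u) v] contracts
    the lift [F] to the geodesic with the same endpoint.  The second half goes back along [F']. *)
Lemma lifts_to_homotopic p q g : lifts_to p g -> lifts_to q g -> loop_homotopic (None : rose) p q.
Proof.
move=> [F [Fc Fp F0 F1]] [F' [F'c F'p F'0 F'1]].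
pose u (a b : R) (z : R * R) := clip (0 + 1 * (z.2 + 1 * clip (a + b * z.1))).
have uc a b : continuous (u a b).
  apply: (@clip_affine_continuous _ _ (fun z : R * R => z.2 + 1 * clip (a + b * z.1))) => z.
  apply: cvgD; first exact: cvg_snd.
  apply: cvgM; first exact: cvg_cst.
  by apply: (@clip_affine_continuous _ _ fst) => ?; exact: cvg_fst.
have uE a b s t : u a b (s, t) = clip (t + clip (a + b * s)).
  by rewrite /u /= !mul1r add0r.
pose H (E : R -> T) a b z := (scale (E (u a b z)) (u (- a) (- b) z)).2.
have Hc E a b : dcts dist I01 E -> dcts rdist (I01 `*` I01) (H E a b).
  move=> Ec; apply: proj_dcts; apply: scale_dcts => [||z _]; [|exact: uc|exact: clip_itv].
  by apply: dcts_comp Ec => // z _; exact: clip_I01.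
have I0 : I01 0 by rewrite I01E lexx ler01.
have I1 : I01 1 by rewrite I01E lexx ler01.
have start E a b s : E 0 = base -> H E a b (s, 0) = None.
  move=> E0; rewrite /H !uE !add0r; case: (lerP 0 (a + b * s)) => ab.
    by rewrite (clip_le0 (_ : - a + - b * s <= 0)) ?(clip_le0 (lexx 0)) ?tree_scale0 //; lra.
  by rewrite (clip_le0 (ltW ab)) (clip_le0 (lexx 0)) E0 tree_scale_base.
have stop E a b s : E 1 = (g, None) -> H E a b (s, 1) = None.
  have clip1 r : clip (1 + clip r) = 1 :> R by rewrite clip_ge1 // lerDl clip_ge0.
  by move=> E1; rewrite /H !uE !clip1 E1 tree_scale1.
(* For [s <= 1/4], [u = t] while [v] falls from 1 to [t]; up to [s = 1/2], [v = t] while [u] rises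
   to 1. Both halves then meet in the geodesic to [g]. *)
exists (fun z => if z.1 <= 2^-1 then H F (- 1) 4 z else H F' 3 (- 4) z).
  apply/within_dcts; apply: (@dcts_paste _ _ _ _ _ fst); [by move=> z; exact: cvg_fst| |exact: Hc|exact: Hc].
  move=> [s t] [_ /=]; rewrite I01E => t01 ->; rewrite /H !uE.
  rewrite (_ : - 1 + 4 * 2^-1 = 1); last lra.
  rewrite (_ : - - 1 + - 4 * 2^-1 = - 1); last lra.
  rewrite (_ : 3 + - 4 * 2^-1 = 1); last lra.
  rewrite (_ : - 3 + - - 4 * 2^-1 = - 1); last lra.
  rewrite (clip_ge1 (lexx 1)) (clip_le0 (_ : - 1 <= 0 :> R)) ?addr0; last lra.
  by rewrite (clip_ge1 (_ : 1 <= t + 1)) ?F1 ?F'1 //; lra.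
split=> [t It|t It|s Is] /=.
- rewrite invr_ge0 ler0n /H !uE !mulr0 !addr0 opprK.
  rewrite (clip_le0 (_ : - 1 <= 0 :> R)) ?addr0; last lra.
  rewrite (clip_ge1 (lexx 1)) (clip_id (_ : 0 <= t <= 1)); last by rewrite -I01E.
  by rewrite clip_ge1 ?tree_scale1 ?Fp //; move: It; rewrite I01E; lra.
- rewrite ifF; last by apply/negbTE; rewrite -ltNge; lra.
  rewrite /H !uE !mulr1 opprK (_ : 3 + - 4 = - 1); last lra.
  rewrite (_ : - 3 + 4 = 1); last lra.
  rewrite (clip_le0 (_ : - 1 <= 0 :> R)) ?addr0; last lra.
  rewrite (clip_ge1 (lexx 1)) (clip_id (_ : 0 <= t <= 1)); last by rewrite -I01E.
  by rewrite clip_ge1 ?tree_scale1 ?F'p //; move: It; rewrite I01E; lra.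
by rewrite !start ?stop //; case: ifP.
Qed.

(** The homotopy is lifted over the square. On the sides where it stays at the base point the lift
    is constant, so the lifts of [p] and [q] have the same ends. *)
Lemma homotopic_lifts_to p q g h : loop_homotopic (None : rose) p q ->
  lifts_to p g -> lifts_to q h -> g = h.
Proof.
move=> [H /within_dcts Hc [Hp Hq Hb]] pg qh.
pose K := I01 `*` I01.
have Kc : compact K by apply: compact_setX; exact: I01_compact.
have [I0 Is] := I01_star.
have Ks : star_shaped (K : set (R * R)%type).
  by split=> [|[x y] t [Kx Ky] t01]; [|split; exact: Is].
have I1 : I01 1 by rewrite I01E lexx ler01.
have [L [Lc LH L0]] := lift_map B 1%g Kc Ks Hc.
have H00 : H (0, 0) = None by have [] := Hb 0 I0.
have pairc (a : R) : continuous (fun t : R => (a, t)).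
  by move=> t; exact: (@cvg_pair _ _ _ _ (nbhs a) (nbhs t) _ _ _ (cst a) id (cvg_cst a) cvg_id).
have pairc' (a : R) : continuous (fun t : R => (t, a)).
  by move=> t; exact: (@cvg_pair _ _ _ _ (nbhs t) (nbhs a) _ _ _ id (cst a) cvg_id (cvg_cst a)).
have L00 : L (0, 0) = base by rewrite [LHS]L0 [H _]H00.
have L10 : L (1, 0) = base.
  rewrite -L00; apply: (lift_const_path Lc (pairc' 0)) => t It; first by split.
  rewrite !LH; [|by split|by split].
  by have [-> _] := Hb t It; rewrite H00.
have L11 : L (1, 1) = L (0, 1).
  apply: (lift_const_path Lc (pairc' 1)) => t It; first by split.
  rewrite !LH; [|by split|by split].
  by have [_ ->] := Hb t It; have [_ ->] := Hb 0 I0.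
have lp : lifts_to p (L (0, 1)).1.
  exists (fun t => L (0, t)); split=> //.
  - by apply: (dcts_comp (pairc 0) _ Lc) => t It; split.
  - by move=> t It; rewrite LH ?Hp //; split.
  have [_ <-] := Hb 0 I0; rewrite -LH; last by split.
  exact: surjective_pairing.
have lq : lifts_to q (L (1, 1)).1.
  exists (fun t => L (1, t)); split=> //.
  - by apply: (dcts_comp (pairc 1) _ Lc) => t It; split.
  - by move=> t It; rewrite LH ?Hq //; split.
  have [_ <-] := Hb 1 I1; rewrite -LH; last by split.
  exact: surjective_pairing.
by rewrite (lifts_to_uniq pg lp) (lifts_to_uniq qh lq) L11.
Qed.

Lemma rose_pi1 : pi1_isomorphic R (None : rose) G.
Proof.
exists monodromy; split=> [p q /monodromyP pl /monodromyP ql|p q /monodromyP pl /monodromyP ql|g].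
- exact/monodromyE/lifts_to_cat.
- split=> [e|pq]; last exact: homotopic_lifts_to pq pl ql.
  by apply: lifts_to_homotopic pl _; rewrite e.
have I1 : I01 1 by rewrite I01E lexx ler01.
(* The loop with monodromy [g] is the projection of the geodesic from [1] to [g]. *)
pose F t := scale (g, None) t.
have Fc : dcts dist I01 F.
  apply: (scale_dcts (F := fun=> (g, None)) (s := id)) => [|t|t]; last by rewrite I01E.
    by apply: dcts_cst; rewrite tree_distxx.
  exact: cvg_id.
exists (fun t => (F t).2); last first.
  by apply: monodromyE; exists F; split; rewrite // /F ?tree_scale0 ?tree_scale1.
split; [apply/within_dcts; exact: proj_dcts| |]; by rewrite /F ?tree_scale0 ?tree_scale1.
Qed.

Lemma cube_star n : star_shaped (@cube R n).
Proof.
split=> [i|x t Kx /andP[t0 t1] i]; rewrite mxE ?lexx ?ler01 //.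
have /andP[x0 x1] := Kx i.
by rewrite mulr_ge0 //= -[leRHS]mulr1 ler_pM.
Qed.

Lemma cube_compact n : compact (@cube R n).
Proof.
have -> : @cube R n = [set v : 'rV[R]_n | forall i, `[0, 1]%classic (v ord0 i)].
  by apply/seteqP; split=> v /= h i; have := h i; rewrite in_itv.
by apply: (@rV_compact R n (fun=> `[0, 1]%classic)) => i; exact: segment_compact.
Qed.

(** The boundary of the cube is connected by segments, so the lift of [f] is constant there;
    shrinking the lift to [1] in the tree fixes that value. *)
Lemma rose_pi_trivial n : (2 <= n)%N -> pi_trivial R n (None : rose).
Proof.
move=> n2 f /within_dcts fc fbd.
have [i0 [j0 ij0]] : exists i j : 'I_n, i != j.
  by exists (Ordinal (ltnW n2)), (Ordinal n2).
have bd0 : cube_bd (0 : 'rV[R]_n).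
  by split; [case: (cube_star n)|exists i0; left; rewrite mxE].
have f0 : f 0 = None := fbd _ bd0.
have [L [Lc Lf L0]] := lift_map B 1%g (cube_compact (n := n)) (cube_star n) fc.
have seg (x y : 'rV[R]_n) :
    (forall t, I01 t -> cube_bd (x + t *: (y - x))) -> L y = L x.
  move=> xybd; have hc : continuous (fun t : R => x + t *: (y - x)).
    by move=> t; apply: cvgD; [exact: cvg_cst|exact: scalel_continuous].
  have e0 : x + 0 *: (y - x) = x by rewrite scale0r addr0.
  have e1 : x + 1 *: (y - x) = y by rewrite scale1r addrC subrK.
  have := lift_const_path Lc hc; rewrite e0 e1; apply.
    by move=> t /xybd[].
  have I0 : I01 0 by rewrite I01E lexx ler01.
  move=> t It; have bt := xybd t It; have b0 := xybd 0 I0.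
  rewrite e0 in b0.
  by rewrite !Lf ?fbd //; [case: b0|case: bt].
have conv (a b t : R) : 0 <= a <= 1 -> 0 <= b <= 1 -> I01 t -> 0 <= a + t * (b - a) <= 1.
  by rewrite I01E => ? ? ?; apply/andP; split; nra.
have segE (x y : 'rV[R]_n) t i : (x + t *: (y - x)) ord0 i = x ord0 i + t * (y ord0 i - x ord0 i).
  by rewrite !mxE.
have Lbd x : cube_bd x -> L x = base.
  move=> [xc [i [xi|xi]]].
    rewrite (@seg 0 x) ?L0 ?f0 // => t It; split=> [l|].
      by rewrite segE; apply: conv => //; rewrite mxE lexx ler01.
    by exists i; left; rewrite segE xi mxE subrr mulr0 addr0.
  (* The face [x_i = 1] misses the origin. It is reached through its vertex [e], joined to 0 inside
     a face [x_j = 0] with [j != i]; this is where [2 <= n] enters. *)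
  have [j ji] : exists j, j != i.
    by have [<-|] := eqVneq i0 i; [exists j0; rewrite eq_sym|exists i0].
  pose e : 'rV[R]_n := delta_mx ord0 i.
  have ei : e ord0 i = 1 by rewrite mxE !eqxx.
  have ec l : 0 <= e ord0 l <= 1 by rewrite mxE ler0n lern1 eqxx; case: (l == i).
  rewrite (@seg e x); last first.
    move=> t It; split=> [l|]; first by rewrite segE; exact: conv.
    by exists i; right; rewrite segE xi ei subrr mulr0 addr0.
  rewrite (@seg 0 e) ?L0 ?f0 // => t It; split=> [l|].
    by rewrite segE; apply: conv => //; rewrite mxE lexx ler01.
  exists j; left; rewrite segE mxE /e mxE eqxx /= (negbTE ji).
  by rewrite subrr mulr0 addr0.
exists (fun z => (scale (L z.2) (clip (1 + (- 1) * z.1))).2).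
  apply/within_dcts/proj_dcts/scale_dcts => [||z _]; last exact: clip_itv.
    by apply: (dcts_comp (h := snd) _ _ Lc) => [z|z []//]; exact: cvg_snd.
  by apply: (@clip_affine_continuous _ _ fst) => z; exact: cvg_fst.
split=> [x Kx|x Kx|s x _ xbd] /=.
- by rewrite mulr0 addr0 clip_ge1 // tree_scale1 Lf.
- by rewrite mulr1 subrr clip_le0 // tree_scale0.
by rewrite Lbd // tree_scale_base.
Qed.

Lemma rose_eilenberg_maclane1 : eilenberg_maclane1 R rose G.
Proof.
split; first exact: rose_path_connected.
by exists None; split; [exact: rose_pi1|exact: rose_pi_trivial].
Qed.

End Aspherical.

(** * The cell structure of the rose *)

Section RoseComplex.
Variables (R : realType) (k : nat).
Local Notation rose := (rose R k).

Definition rose_cell (n : nat) : Type :=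
  match n with 0 => unit | 1 => 'I_k | _ => void end.

Definition rose_map (n : nat) : rose_cell n -> 'rV[R]_n -> rose :=
  match n with
  | 0 => fun _ _ => None
  | 1 => fun i v => petal i ((v ord0 ord0 + 1) / 2)
  | _ => fun _ _ => None
  end.

Lemma petal_continuous (i : 'I_k) : continuous (petal i : R -> rose).
Proof.
move=> t; apply/(@metricType_numDomainType.cvgrPdist_lt R rose R (nbhs t)) => d d0.
have /cvgrPdist_lt /(_ d d0) : (fun u : R => u) @ t --> t by exact: cvg_id.
by apply: filterS => u tu; rewrite mdist_rose; exact: le_lt_trans (rdist_petal _ _ _) tu.
Qed.

Lemma rose_map_continuous n (e : rose_cell n) : continuous (rose_map e).
Proof.
case: n e => [e|[i|n []]]; first exact: (@cst_continuous _ _ (None : rose)).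
pose c (v : 'rV[R]_1) : R := (v ord0 ord0 + 1) / 2.
have cc : continuous c.
  move=> v; apply: (@continuousM R _ (fun v : 'rV[R]_1 => v ord0 ord0 + 1) (cst 2^-1)).
    apply: (@continuousD R _ _ (fun v : 'rV[R]_1 => v ord0 ord0) (cst 1)).
      exact: coord_continuous.
    exact: cst_continuous.
  exact: cst_continuous.
by move=> v; exact: (continuous_comp (cc v) (@petal_continuous i (c v))).
Qed.

Lemma open_disk1 (v : 'rV[R]_1) : open_disk v -> 0 < (v ord0 ord0 + 1) / 2 < 1.
Proof. by rewrite /open_disk /= big_ord1 expr2 => v1; apply/andP; split; nra. Qed.

Lemma open_disk_const (t : R) : 0 < t < 1 -> open_disk (const_mx (2 * t - 1) : 'rV[R]_1).
Proof. by move=> t01; rewrite /open_disk /= big_ord1 mxE expr2; nra. Qed.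

Local Notation open_cell e := (rose_map (projT2 e) @` @open_disk R (projT1 e)).

Lemma rose_map_inj n (e : rose_cell n) : set_inj (@open_disk R n) (rose_map e).
Proof.
case: n e => [|[|n]] e v w; rewrite !inE; [by move=> _ _ _; apply/rowP => -[]| |by case: e].
move=> /open_disk1 v01 /open_disk1 w01; rewrite /= !petalE => -[vw].
by apply/rowP => i; rewrite (ord1 i); lra.
Qed.

Lemma rose_partition (z : rose) : exists! e : {n & rose_cell n}, open_cell e z.
Proof.
case: (roseP z) => [|i t t01].
  exists (existT _ 0%N tt); split.
    by exists 0 => //; rewrite /open_disk /= big_ord0 ltr01.
  move=> [[|[|n]] e] /= [v dv]; [by case: e| |by case: e].
  by rewrite petalE //; exact: open_disk1.
exists (existT _ 1%N i); split.
  exists (const_mx (2 * t - 1)); first exact: open_disk_const.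
  by rewrite /= mxE; congr petal; lra.
move=> [[|[|n]] e] /= [v dv]; [by rewrite petalE| |by case: e].
by rewrite !petalE => [|//]; [exact: open_disk1|move=> v01 [-> _]].
Qed.

Lemma rose_boundary n (e : rose_cell n) : exists F : set {m & rose_cell m},
  [/\ finite_set F, forall c, F c -> (projT1 c < n)%N
    & rose_map e @` @sphere R n `<=` \bigcup_(c in F) open_cell c].
Proof.
case: n e => [|[|n]] e; last by case: e.
  exists set0; split=> // z [v]; rewrite /sphere /= big_ord0 => /eqP.
  by rewrite eq_sym oner_eq0.
exists [set existT _ 0%N tt]; split=> [|c -> //|z [v]].
  exact: finite_set1.
rewrite /sphere /= big_ord1 => v1 <-; exists (existT _ 0%N tt) => //=.
exists 0; first by rewrite /open_disk /= big_ord0 ltr01.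
have : (v ord0 ord0 - 1) * (v ord0 ord0 + 1) = 0 by rewrite -subr_sqr_1 v1 subrr.
move=> /eqP; rewrite mulf_eq0 => /orP[/eqP e1|/eqP ->]; last by rewrite mul0r petal0.
by have -> : (v ord0 ord0 + 1) / 2 = 1 by [lra]; rewrite petal1.
Qed.

Lemma disk1_closed : closed (@disk R 1).
Proof.
have -> : @disk R 1 = (fun v : 'rV[R]_1 => v ord0 ord0 * v ord0 ord0) @^-1` [set x | x <= 1].
  by apply/seteqP; split=> v; rewrite /disk /= big_ord1 expr2.
apply: closed_comp; last exact: closed_le.
move=> v _; apply: (@continuousM R _ (fun v : 'rV[R]_1 => v ord0 ord0) (fun v => v ord0 ord0));
  exact: coord_continuous.
Qed.

Lemma disk1_compact : compact (@disk R 1).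
Proof.
apply: bounded_closed_compact; last exact: disk1_closed.
exists 1; split=> // M M1 v; rewrite /disk /= big_ord1 => v1.
apply: le_trans (ltW M1); rewrite /Num.norm /= mx_normrE.
apply/bigmax_leP; split=> // -[i j] _ /=; rewrite (ord1 i) (ord1 j) ler_norml.
by move: v1; rewrite expr2; nra.
Qed.

(** Finiteness of the set of petals is essential: a set closed in every cell is a finite union of
    images of compact sets, hence closed for the metric. *)
Lemma rose_weak (A : set rose) : closed A <->
  forall n (e : rose_cell n), closed (@disk R n `&` rose_map e @^-1` A).
Proof.
split=> [Ac n e|Ac].
  have preim_closed : closed (rose_map e @^-1` A).
    by apply: closed_comp Ac => v _; exact: rose_map_continuous.
  case: n e preim_closed => [|[|n]] e preim_closed; last by case: e.
    have -> : @disk R 0 = setT by apply/seteqP; split=> // v _; rewrite /disk /= big_ord0 ler01.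
    by rewrite setTI.
  by apply: closedI; first exact: disk1_closed.
have AE : A = (A `&` [set None]) `|` \bigcup_(i in [set: 'I_k])
    (rose_map (i : rose_cell 1) @` (@disk R 1 `&` rose_map (i : rose_cell 1) @^-1` A)).
  apply/seteqP; split=> [z Az|z [[]//|[i _ [v [_ Av] <-]//]]].
  case: (roseP z) Az => [|i t t01] Az; first by left.
  have pE : rose_map (i : rose_cell 1) (const_mx (2 * t - 1)) = petal i t.
    by rewrite /= mxE; congr petal; lra.
  right; exists i => //; exists (const_mx (2 * t - 1)) => //.
  split; last by rewrite /preimage /= mxE (_ : (2 * t - 1 + 1) / 2 = t) //; lra.
  by have := open_disk_const t01; rewrite /open_disk /disk /= => /ltW.
rewrite AE; apply: closedU.
  have [A0|nA0] := pselect (A None).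
    have -> : A `&` [set None] = [set None] by apply/seteqP; split=> [z []//|z ->].
    exact: accessible_closed_set1 (hausdorff_accessible (@metric_hausdorff R rose)) _.
  have -> : A `&` [set None] = set0.
    by apply/seteqP; split=> // z [Az z0]; apply: nA0; rewrite -z0.
  exact: closed0.
apply: closed_bigcup => [|i _]; first exact: finite_finset.
apply: compact_closed; first exact: metric_hausdorff.
apply: continuous_compact.
  by apply: continuous_subspaceT; exact: rose_map_continuous.
apply: (subclosed_compact _ disk1_compact) => //; exact: Ac.
Qed.

Definition rose_complex : cw_complex R :=
  @CWComplex R rose rose_cell rose_map (@metric_hausdorff R rose)
    (fun n e => continuous_subspaceT (@rose_map_continuous n e))
    rose_map_inj rose_partition rose_boundary rose_weak.

Lemma free_type_F (G : groupType) (B : free_basis G k) n : type_F R G n.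
Proof.
exists rose_complex; split; first exact: rose_eilenberg_maclane1.
by move=> [|[|i]] _; exact: finite_finset.
Qed.

End RoseComplex.

Theorem theorem6 (R : realType) :
  exists G1 G2 : sgraph,
    let B1 : groupType := bestvina_brady G1 in
    let B2 : groupType := bestvina_brady G2 in
    (forall j : nat, type_F R B1 j <-> type_F R B2 j) /\
    (forall j : nat, type_FP B1 j <-> type_FP B2 j) /\
    finitely_presented B1 /\ finitely_presented B2 /\
    (forall (P1 : fin_presentation B1) (P2 : fin_presentation B2),
       dehn_equivalent (dehn P1) (dehn P2)) /\
    (forall (S1 : gen_family B1) (S2 : gen_family B2),
       asdim (word_space R S1) = asdim (word_space R S2)) /\
    [set n : nat | coarsely_embeds R (F2pow n) B1] <>
    [set n : nat | coarsely_embeds R (F2pow n) B2].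
Proof.
exists (star 1), (star 2) => /=; pose C1 := star_basis 1; pose C2 := star_basis 2.
split; [by move=> j; split=> _; [exact: free_type_F C2 j|exact: free_type_F C1 j]|].
split; [by move=> j; split=> _; [exact: free_type_FP C2 j|exact: free_type_FP C1 j]|].
split; [exact: free_finitely_presented C1|].
split; [exact: free_finitely_presented C2|].
split; [by move=> P1 P2; exact: free_dehn_equivalent C1 C2 P1 P2|].
split; [by move=> S1 S2; rewrite (free_asdim R C1) // (free_asdim R C2)|].
(* The two sets are told apart at [n = 1]. *)
move=> /(congr1 (fun A : set nat => A 1%N)) /= e.
have : coarsely_embeds R (F2pow 1) (bestvina_brady (star 1)).
  by rewrite e; exact: free_embeds F2pow1_basis C2.
exact: free_not_embeds F2pow1_basis C1.
Qed.
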